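(* Let $\mathcal T$ be a minimally complete abstract Newton tree at infinity. Define a binary relation $\sim$ on the set $P_S(\mathcal T)$ by declaring that, for $(u,e),(u',e')\in P_S(\mathcal T)$, $$(u,e)\sim(u',e')\iff\text{one of }(u,e),(u',e')\text{ is a comb over the other.}$$ Then $\sim$ is an equivalence relation on $P_S(\mathcal T)$ and each equivalence class is totally ordered by $\preceq$.
   Context: **Decorated rooted trees.** A rooted tree is a finite tree with set of cells $X_0$, edges (2-element subsets of $X_0$) and a root $v_0\in X_0$; $\delta_x$ is the valency of $x$, and $\gamma_{x,y}$ the unique path from $x$ to $y$. Arrows: $\mathcal A=\{x:\delta_x=1\}\setminus\{v_0\}$; vertices: $\mathcal V=X_0\setminus\mathcal A$. For distinct $x,y$, $x<y$ means that $x$ is on $\gamma_{v_0,y}$. In a decorated rooted tree, each arrow is decorated by $(0)$ or $(1)$ ($\mathcal A_0$ = set of arrows decorated by $(0)$), and each pair $(e,x)$ with $e$ an edge and $x\in e$ carries an integer $q(e,x)$ (decoration of $e$ near $x$). $Q(e,x)=\prod q(e',x)$ over edges $e'\ne e$ incident to $x$ (empty products are $1$). For an edge $e=\{x,y\}$ with $x,y\in\mathcal V$, $\det(e)=q(e,x)q(e,y)-Q(e,x)Q(e,y)$. A dead end is an edge incident to an element of $\mathcal A_0$. **Abstract Newton tree at infinity**: a decorated rooted tree such that (1) for each $v\in\mathcal V$ some $\alpha\in\mathcal A\setminus\mathcal A_0$ satisfies $\alpha>v$; (2) at most one dead end is incident to a given vertex; (3) $q(e,v_0)=1$ for all edges $e$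 incident to $v_0$; (4) $q(e,\alpha)=1$ for every edge $e$ incident to an arrow $\alpha$; (5) for $v\in\mathcal V$ and distinct edges $e,e'$ incident to $v$, $q(e,v)$ and $q(e',v)$ are coprime; with $E_v^+$ the set of edges $\{v,x\}$ with $v<x$, $q(e,v)\ge1$ for all $e\in E_v^+$, at most one $e\in E_v^+$ has $q(e,v)>1$, and if a dead end $\epsilon$ is incident to $v$ then $q(\epsilon,v)=\max_{e\in E_v^+}q(e,v)$; (6) $\det(e)<0$ for every edge $e$ joining two vertices. For $v\in\mathcal V$, $\alpha\in\mathcal A\setminus\mathcal A_0$: $x_{v,\alpha}$ is the product of $q(\epsilon,u)$ over all edges $\epsilon$ not in $\gamma_{v,\alpha}$ but incident to a cell $u$ of $\gamma_{v,\alpha}$; $N_v=\sum_{\alpha\in\mathcal A\setminus\mathcal A_0}x_{v,\alpha}$. A dicritical vertex is a vertex with $N_v=0$. The tree is **minimally complete** if (i) $N_v\ge0$ for all $v\in\mathcal V$ and each arrow decorated by $(1)$ is adjacent to a dicritical vertex; (ii) a dead end is incident to each dicritical vertex; (iii) if a dead end $e$ incident to a vertex $v$ has $q(e,v)=1$ then $v$ is dicritical; (iv) every vertex $\ne v_0$ has valency $\ne2$. **Notation.** $\mathcal N=\{v\in\mathcal V:N_v>0\}$ (a subtree containing $v_0$; an edge of $\mathcal N$ is an edge with both endpoints in $\mathcal N$). $\mathcal D_v$: set of dicritical vertices adjacent to $v$. Degree $d_u$ of a dicritical $u$: number of $(1)$-arrows adjacent to $u$. For a dicritical $u$, $k_u=-\det(\{u,v\})$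 where $v$ is the unique vertex adjacent to $u$ (one has $v\in\mathcal N$). $v\in\mathcal N$ is a node if $\mathcal D_v\neq\emptyset$. $a_v=q(e,v)$ if a dead end $e$ is incident to $v$, $a_v=1$ otherwise. $r_v=-1+$ (number of vertices adjacent to $v$). $\epsilon(v)$: number of elements of $\mathcal N$ adjacent to $v$. For $v\in\mathcal N$: $\widetilde\Delta(v)=(r_v-1)(N_v-1)+N_v(1-\frac1{a_v})-\sum_{u\in\mathcal D_v}(d_u-1)$, and $\widetilde\Delta(S)=\sum_{v\in S}\widetilde\Delta(v)$ for $S\subseteq\mathcal N$. $d(v)=N_v$ if $v$ is not a node, $d(v)=\gcd\{d_u:u\in\mathcal D_v\}$ if $v$ is a node. **Characteristic numbers.** $P$ is the set of pairs $(u,e)$ with $u\in\mathcal N$ and $e$ an edge of $\mathcal N$ incident to $u$; it is partially ordered by: $(u',e')\prec(u,e)$ iff $\gamma_{u',u}$ contains $e$ but not $e'$. Let $(u,e)\in P$, $e=\{u,u_0\}$. If $\epsilon(u_0)=1$, $c(u,e)=d(u_0)/a_{u_0}$. Otherwise, with $u,u_1,\dots,u_n$ the elements of $\mathcal N$ adjacent to $u_0$ and $e_i=\{u_0,u_i\}$, $c(u,e)=\gcd(d(u_0),c(u_0,e_1),\dots,c(u_0,e_n))/a_{u_0}$, where the gcd of rationals is the nonnegative generator of the $\mathbb Z$-module they generate. $M(u,e)=N_u/c(u,e)$. For $A$ a set of edges of $\mathcal N$ incident to $u$, $R(u,A)=\sum_{x\in\mathcal D_u}(1-\frac1{k_x})+(1-\frac1{a_u})+\sum_{e\in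 A}(1-\frac1{M(u,e)})$. **Teeth, skeleton.** A $\widetilde\Delta$-trivial path is a path $(z_1,\dots,z_n)$ in $\mathcal N$ with $n>1$, $\epsilon(z_1)=1$, and $\epsilon(z_i)=2$, $\widetilde\Delta(z_i)=0$ for $1<i<n$. $\Gamma$: set of $\widetilde\Delta$-trivial paths with $\widetilde\Delta(z_1)\le0<\widetilde\Delta(\{z_1,\dots,z_n\})$ and $z_{n-1}>z_n$. $W$: set of last vertices $z_n$ of elements of $\Gamma$. For $w\in W$, $\bar V(w)$ is the set of all vertices lying on some element of $\Gamma$ with last vertex $w$. $(u,e)\in P$ is a tooth if there is $(z_1,\dots,z_n)\in\Gamma$ with $z_n=u$ and $\{z_n,z_{n-1}\}=e$. Skeleton: $S(\mathcal T)=\mathcal N\setminus\bigcup_{w\in W}(\bar V(w)\setminus\{w\})$. $P_S(\mathcal T)=\{(u,e)\in P:u\in S(\mathcal T)\}$. **Combs.** $(u,e)\in P$ is a comb over $(u',e')\in P$ if $(u,e)\succeq(u',e')$ and every $(v,f)\in P$ with $(u,e)\succ(v,f)\succeq(u',e')$ satisfies: (a) $\epsilon(v)\in\{2,3\}$; (b) if $\epsilon(v)=2$ then $R(v,\{f\})<1$; (c) if $\epsilon(v)=3$ then $R(v,\{f\})=0$ and $(v,g)$ is a tooth, where $g$ is the unique edge of $\mathcal N$ incident to $v$, not in $\gamma_{u,v}$ and distinct from $f$. *)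

(* Defs.v *)
From HB Require Import structures.
From mathcomp Require Import all_boot all_order all_algebra.
From mathcomp Require Import ring.

Set Implicit Arguments.
Unset Strict Implicit.
Unset Printing Implicit Defensive.

Import Order.TTheory GRing.Theory Num.Theory.
Local Open Scope ring_scope.

(** * Relations restricted to a predicate *)

Definition equivalence_on (A : Type) (D : A -> Prop) (R : A -> A -> Prop) : Prop :=
  [/\ forall x, D x -> R x x,
      forall x y, D x -> D y -> R x y -> R y x &
      forall x y z, D x -> D y -> D z -> R x y -> R y z -> R x z].

Definition class_on (A : Type) (D : A -> Prop) (R : A -> A -> Prop) (x : A) :
    A -> Prop := fun y => D y /\ R x y.

Definition total_order_on (A : Type) (C : A -> Prop) (R : A -> A -> Prop) : Prop :=
  [/\ forall x, C x -> R x x,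
      forall x y, C x -> C y -> R x y -> R y x -> x = y,
      forall x y z, C x -> C y -> C z -> R x y -> R y z -> R x z &
      forall x y, C x -> C y -> R x y \/ R y x].

(** * Gcd of a list of rationals *)

Definition gcdq2 (x y : rat) : rat :=
  (gcdz (numq x * denq y) (numq y * denq x))%:~R / (denq x * denq y)%:~R.

Definition gcdq (s : seq rat) : rat := foldr gcdq2 0 s.

Lemma gcdq2P (x y : rat) :
  [/\ 0 <= gcdq2 x y,
     exists k : int, x = k%:~R * gcdq2 x y,
     exists k : int, y = k%:~R * gcdq2 x y &
     exists a b : int, gcdq2 x y = a%:~R * x + b%:~R * y].
Proof.
have dx : (denq x)%:~R != 0 :> rat by rewrite intr_eq0 denq_neq0.
have dy : (denq y)%:~R != 0 :> rat by rewrite intr_eq0 denq_neq0.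
rewrite /gcdq2; set m := numq x * denq y; set n := numq y * denq x.
have xE : x = m%:~R / (denq x * denq y)%:~R.
  by rewrite -[LHS]divq_num_den /m !intrM -mulf_div divff // mulr1.
have yE : y = n%:~R / (denq x * denq y)%:~R.
  by rewrite -[LHS]divq_num_den /n !intrM (mulrC (denq x)%:~R) -mulf_div divff // mulr1.
split.
- by rewrite divr_ge0 // ler0z ?gcdz_ge0 // mulr_ge0 // denq_ge0.
- have /dvdzP [k kE] := dvdz_gcdl m n.
  by exists k; rewrite [LHS]xE {1}kE intrM mulrA.
- have /dvdzP [k kE] := dvdz_gcdr m n.
  by exists k; rewrite [LHS]yE {1}kE intrM mulrA.
have [a [b abE]] := Bezoutz m n.
exists a, b; have -> : a%:~R * x + b%:~R * y = (a%:~R * m%:~R + b%:~R * n%:~R) / (denq x * denq y)%:~R.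
  by rewrite mulrDl -!mulrA -xE -yE.
by rewrite -abE intrD !(intrM _ a) !(intrM _ b).
Qed.

(* [gcdq s] is the nonnegative generator of the Z-module generated by [s]. *)
Lemma gcdqP (s : seq rat) : 0 <= gcdq s /\
  forall z : rat, (exists k : int, z = k%:~R * gcdq s) <->
    (exists c : nat -> int, z = \sum_(i < size s) (c i)%:~R * s`_i).
Proof.
elim: s => [|x s [IH0 IH]] /=.
  split=> // z; split=> [[k ->]|[c ->]]; last by exists 0; rewrite big_ord0 mulr0.
  by exists (fun=> 0); rewrite big_ord0 mulr0.
have [g0 [k1 k1E] [k2 k2E] [a [b abE]]] := gcdq2P x (gcdq s).
move: (gcdq2 x _) g0 k1E k2E abE => g g0 k1E k2E abE.
split=> // z; split=> [[k ->]|[c ->]].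
  have [|c cE] := (IH ((k * b)%:~R * gcdq s)).1; first by exists (k * b).
  exists (fun i => if i is j.+1 then c j else k * a).
  by rewrite big_ord_recl /= -cE abE !intrM; ring.
have [|k kE] := (IH (\sum_(i < size s) (c i.+1)%:~R * s`_i)).2.
  by exists (fun i => c i.+1).
exists (c 0%N * k1 + k * k2); rewrite big_ord_recl /= kE k1E k2E intrD !intrM.
by ring.
Qed.

(** * Rooted trees *)

Definition adjacent_in (X : finType) (E : {set {set X}}) : rel X :=
  fun x y => [set x; y] \in E.

(* [x :: p] is a path without repetition from [x] to [y]. *)
Definition simple_path (X : finType) (E : {set {set X}}) (x y : X) (p : seq X) : bool :=
  [&& path (adjacent_in E) x p, last x p == y & uniq (x :: p)].

Record rootedTree := RootedTree {
  cell :> finType;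
  edges : {set {set cell}};
  root : cell;
  card_edge : forall e, e \in edges -> #|e| = 2%N;
  tree_axiom : forall x y : cell, exists! p, simple_path edges x y p
}.

Definition adj (T : rootedTree) : rel T := adjacent_in (edges T).

Lemma simple_path_ex (T : rootedTree) (x y : T) :
  exists p, simple_path (edges T) x y p.
Proof. by have [p [pP _]] := tree_axiom x y; exists p. Qed.

(* The list of all cells of the path, from [x] to [y] (both included). *)
Definition gamma (T : rootedTree) (x y : T) : seq T :=
  x :: xchoose (simple_path_ex x y).

Definition path_edges (X : finType) (s : seq X) : seq {set X} :=
  [seq [set xy.1; xy.2] | xy <- zip s (behead s)].

Definition gamma_edges (T : rootedTree) (x y : T) : seq {set T} :=
  path_edges (gamma x y).

Definition valency (T : rootedTree) (x : T) : nat :=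
  #|[set e in edges T | x \in e]|.

Definition below (T : rootedTree) (x y : T) : bool :=
  (x != y) && (x \in gamma (root T) y).

Definition arrows (T : rootedTree) : {set T} :=
  [set x : T | valency x == 1%N] :\ root T.

Definition vertices (T : rootedTree) : {set T} := ~: arrows T.

(* [arrow1 x] means that the arrow [x] is decorated by (1) rather than (0), and
   [deco e x] is the decoration of the edge [e] near [x].  The values of [arrow1]
   outside arrows, and of [deco] outside incident pairs, are never used. *)
Record decoratedTree := DecoratedTree {
  tree_of :> rootedTree;
  arrow1 : pred tree_of;
  deco : {set tree_of} -> tree_of -> int
}.

Definition arrows0 (T : decoratedTree) : {set T} :=
  [set x in arrows T | ~~ arrow1 x].

Definition arrows1 (T : decoratedTree) : {set T} := arrows T :\: arrows0 T.

Definition codeco (T : decoratedTree) (e : {set T}) (x : T) : int :=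
  \prod_(e' in edges T | (e' != e) && (x \in e')) deco e' x.

Definition edge_det (T : decoratedTree) (e : {set T}) : int :=
  \prod_(x in e) deco e x - \prod_(x in e) codeco e x.

Definition dead_ends (T : decoratedTree) : {set {set T}} :=
  [set e in edges T | [exists x in arrows0 T, x \in e]].

Definition up_edges (T : decoratedTree) (v : T) : {set {set T}} :=
  [set e in edges T | [exists x : T, (e == [set v; x]) && below v x]].

(* In the fifth clause every decoration in the maximum is at least 1 and the
   edges range over a nonempty set, so the default value 0 is never attained. *)
Definition newton_tree_at_infinity (T : decoratedTree) : Prop :=
  (forall v, v \in vertices T -> exists2 x, x \in arrows1 T & below v x) /\
  (forall v e e', v \in vertices T -> e \in dead_ends T -> e' \in dead_ends T ->
     v \in e -> v \in e' -> e = e') /\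
  (forall e, e \in edges T -> root T \in e -> deco e (root T) = 1) /\
  (forall e x, e \in edges T -> x \in arrows T -> x \in e -> deco e x = 1) /\
  (forall v, v \in vertices T ->
     [/\ forall e e', e \in edges T -> e' \in edges T -> v \in e -> v \in e' ->
           e != e' -> coprimez (deco e v) (deco e' v),
         forall e, e \in up_edges v -> 1 <= deco e v,
         forall e e', e \in up_edges v -> e' \in up_edges v ->
           1 < deco e v -> 1 < deco e' v -> e = e' &
         forall e, e \in dead_ends T -> v \in e ->
           deco e v = \big[Order.max/0]_(e' in up_edges v) deco e' v]) /\
  (forall e, e \in edges T -> e \subset vertices T -> edge_det e < 0).

(** * Multiplicities and minimally complete trees *)

Definition xval (T : decoratedTree) (v x : T) : int :=
  \prod_(u <- gamma v x)
    \prod_(e in edges T | (u \in e) && (e \notin gamma_edges v x)) deco e u.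

Definition mult (T : decoratedTree) (v : T) : int :=
  \sum_(x in arrows1 T) xval v x.

Definition dicriticals (T : decoratedTree) : {set T} :=
  [set v in vertices T | mult v == 0].

Definition minimally_complete (T : decoratedTree) : Prop :=
  ((forall v, v \in vertices T -> 0 <= mult v) /\
   (forall x, x \in arrows1 T -> exists2 v, v \in dicriticals T & adj x v)) /\
  (forall v, v \in dicriticals T -> exists2 e, e \in dead_ends T & v \in e) /\
  (forall e v, e \in dead_ends T -> v \in vertices T -> v \in e -> deco e v = 1 ->
     v \in dicriticals T) /\
  (forall v, v \in vertices T -> v != root T -> valency v <> 2%N).

(** * The subtree of vertices of positive multiplicity *)

Definition nset (T : decoratedTree) : {set T} :=
  [set v in vertices T | 0 < mult v].

Definition nedges (T : decoratedTree) : {set {set T}} :=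
  [set e in edges T | e \subset nset T].

Definition dicr_at (T : decoratedTree) (v : T) : {set T} :=
  [set u in dicriticals T | adj v u].

Definition degree (T : decoratedTree) (u : T) : nat :=
  #|[set x in arrows1 T | adj u x]|.

(* A dicritical is adjacent to exactly one vertex, so the choice is forced. *)
Definition kval (T : decoratedTree) (u : T) : int :=
  if [pick v in vertices T | adj u v] is Some v then - edge_det [set u; v] else 0.

Definition aval (T : decoratedTree) (v : T) : int :=
  if [pick e in dead_ends T | v \in e] is Some e then deco e v else 1.

Definition rval (T : decoratedTree) (v : T) : int :=
  - 1 + #|[set x in vertices T | adj v x]|%:Z.

Definition neighbours (T : decoratedTree) (v : T) : {set T} :=
  [set x in nset T | adj v x].

Definition eps (T : decoratedTree) (v : T) : nat := #|neighbours v|.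

Definition Delta (T : decoratedTree) (v : T) : rat :=
  (rval v - 1)%:~R * (mult v - 1)%:~R
  + (mult v)%:~R * (1 - 1 / (aval v)%:~R)
  - \sum_(u in dicr_at v) ((degree u)%:R - 1).

Definition DeltaS (T : decoratedTree) (S : {set T}) : rat := \sum_(v in S) Delta v.

Definition dval (T : decoratedTree) (v : T) : int :=
  if dicr_at v == set0 then mult v
  else (\big[gcdn/0%N]_(u in dicr_at v) degree u)%:Z.

(** * Characteristic numbers *)

Definition other_end (T : rootedTree) (u : T) (e : {set T}) : T :=
  odflt u [pick x in e :\ u].

Definition pairs (T : decoratedTree) : {set T * {set T}} :=
  [set p | [&& p.1 \in nset T, p.2 \in nedges T & p.1 \in p.2]].

Definition prec (T : decoratedTree) (p' p : T * {set T}) : Prop :=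
  (p.2 \in gamma_edges p'.1 p.1) && (p'.2 \notin gamma_edges p'.1 p.1).

Definition preceq (T : decoratedTree) (p' p : T * {set T}) : Prop :=
  p' = p \/ prec p' p.

Fixpoint charnum_rec (T : decoratedTree) (n : nat) (u : T) (e : {set T}) : rat :=
  if n is n'.+1 then
    let u0 := other_end u e in
    if eps u0 == 1%N then (dval u0)%:~R / (aval u0)%:~R
    else gcdq ((dval u0)%:~R ::
               [seq charnum_rec n' u0 [set u0; w] | w <- enum (neighbours u0 :\ u)])
         / (aval u0)%:~R
  else 0.

(* The recursion follows simple paths, so its depth is less than the number of
   cells; [charnumE] below is the defining recursion, free of the bound. *)
Definition charnum (T : decoratedTree) (u : T) (e : {set T}) : rat :=
  charnum_rec #|T| u e.

Lemma gamma_path (T : rootedTree) (x y : T) :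
  exists2 p, gamma x y = x :: p & simple_path (edges T) x y p.
Proof. by exists (xchoose (simple_path_ex x y)) => //; exact: xchooseP. Qed.

Lemma gamma_uniq (T : rootedTree) (x y : T) p :
  simple_path (edges T) x y p -> gamma x y = x :: p.
Proof.
move=> pP; have [p' -> p'P] := gamma_path x y.
by have [r [_ rU]] := tree_axiom x y; rewrite -(rU _ pP) -(rU _ p'P).
Qed.

Lemma adj_neq (T : rootedTree) (x y : T) : adj x y -> x != y.
Proof.
move=> /card_edge; rewrite cards2; by case: (x != y).
Qed.

Lemma adjC (T : rootedTree) (x y : T) : adj x y = adj y x.
Proof. by rewrite /adj /adjacent_in setUC. Qed.

Lemma other_end2 (T : rootedTree) (x y : T) : x != y -> other_end x [set x; y] = y.
Proof.
move=> xy; rewrite /other_end; case: pickP => [z|/(_ y)] /=; rewrite !inE.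
  by case/andP=> /negPf -> /= /eqP.
by rewrite eqxx orbT eq_sym xy.
Qed.

Definition branch (T : rootedTree) (u u0 : T) : {set T} := [set x | u \notin gamma u0 x].

Lemma branch_proper (T : rootedTree) (u u0 w : T) :
  adj u u0 -> adj u0 w -> w != u -> branch u0 w \proper branch u u0.
Proof.
move=> uu0 u0w wu; apply/properP; split.
  apply/subsetP=> x; rewrite !in_set; have [p -> /and3P [pp /eqP pl pu]] := gamma_path w x => u0p.
  have -> : gamma u0 x = u0 :: w :: p.
    by apply: gamma_uniq; rewrite /simple_path /= [adjacent_in _ _ _]u0w pp pl eqxx u0p; exact: pu.
  rewrite inE negb_or (adj_neq uu0) /=; apply/negP=> up.
  have /gamma_uniq E1 : simple_path (edges T) u0 u [:: u].
    rewrite /simple_path /= eqxx !inE andbT.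
    by rewrite [adjacent_in _ _ _]adjC uu0 eq_sym (adj_neq uu0).
  move: up u0p; rewrite inE eq_sym (negPf wu) => up u0p.
  have {pu} : uniq (u0 :: w :: p) by rewrite cons_uniq inE u0p; exact: pu.
  case/splitPr: up pp {pl u0p} => p1 p2; rewrite cat_path => /and3P [pp1 lu _].
  rewrite -cat_rcons -!cat_cons cat_uniq => /and3P [pu _ _].
  have /gamma_uniq : simple_path (edges T) u0 u (w :: rcons p1 u).
    rewrite /simple_path pu [path _ _ _]/= [adjacent_in _ u0 _]u0w rcons_path pp1 lu.
    by rewrite /= last_rcons eqxx.
  by rewrite E1 => -[uw]; rewrite uw eqxx in wu.
exists u0.
  have /gamma_uniq E : simple_path (edges T) u0 u0 [::] by rewrite /simple_path /= eqxx.
  by rewrite in_set E inE (adj_neq uu0).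
rewrite in_set negbK; have [p -> /and3P [_ /eqP <- _]] := gamma_path w u0.
exact: mem_last.
Qed.

Lemma charnum_rec_stable (T : decoratedTree) n m (u u0 : T) :
  adj u u0 -> (#|branch u u0| <= n)%N -> (#|branch u u0| <= m)%N ->
  charnum_rec n u [set u; u0] = charnum_rec m u [set u; u0].
Proof.
have pos (x y : T) : adj x y -> (0 < #|branch x y|)%N.
  move=> xy; apply/card_gt0P; exists y.
  have /gamma_uniq E : simple_path (edges T) y y [::] by rewrite /simple_path /= eqxx.
  by rewrite in_set E inE (adj_neq xy).
elim: n m u u0 => [|n IH] [|m] u u0 uu0 hn hm //.
- by move: (pos _ _ uu0); rewrite ltnNge hn.
- by move: (pos _ _ uu0); rewrite ltnNge hm.
rewrite /= other_end2 ?adj_neq //; case: ifP => // _; congr (gcdq2 _ (foldr _ _ _) / _).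
apply/eq_in_map=> w; rewrite mem_enum !inE => /and3P [wu _ u0w].
have lt := proper_card (branch_proper uu0 u0w wu).
by apply: IH => //; rewrite -ltnS; apply: leq_trans lt _.
Qed.

Lemma charnumE (T : decoratedTree) (u u0 : T) : adj u u0 ->
  charnum u [set u; u0] =
  if eps u0 == 1%N then (dval u0)%:~R / (aval u0)%:~R
  else gcdq ((dval u0)%:~R ::
             [seq charnum u0 [set u0; w] | w <- enum (neighbours u0 :\ u)])
       / (aval u0)%:~R.
Proof.
move=> uu0; rewrite {1}/charnum.
rewrite (@charnum_rec_stable _ _ #|T|.+1) // ?max_card //; last exact/leqW/max_card.
by rewrite /= other_end2 ?adj_neq.
Qed.

Definition Mval (T : decoratedTree) (u : T) (e : {set T}) : rat :=
  (mult u)%:~R / charnum u e.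

Definition Rval (T : decoratedTree) (u : T) (A : {set {set T}}) : rat :=
  \sum_(x in dicr_at u) (1 - 1 / (kval x)%:~R)
  + (1 - 1 / (aval u)%:~R)
  + \sum_(e in A) (1 - 1 / Mval u e).

(** * Teeth and skeleton *)

(* Indices are shifted by one: [z_i] is [nth (root T) z i.-1]. *)
Definition trivial_path (T : decoratedTree) (z : seq T) : Prop :=
  [/\ (1 < size z)%N, {subset z <= nset T},
      sorted (@adj T) z /\ uniq z,
      eps (nth (root T) z 0) = 1%N &
      forall i, (0 < i < (size z).-1)%N ->
        eps (nth (root T) z i) = 2%N /\ Delta (nth (root T) z i) = 0].

Definition Gamma (T : decoratedTree) (z : seq T) : Prop :=
  [/\ trivial_path z,
      Delta (nth (root T) z 0) <= 0,
      0 < DeltaS [set x in z] &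
      below (nth (root T) z (size z).-1) (nth (root T) z (size z).-2)].

Definition Wset (T : decoratedTree) (w : T) : Prop :=
  exists2 z, Gamma z & nth (root T) z (size z).-1 = w.

Definition Vbar (T : decoratedTree) (w x : T) : Prop :=
  exists z, [/\ Gamma z, nth (root T) z (size z).-1 = w & x \in z].

Definition tooth (T : decoratedTree) (u : T) (e : {set T}) : Prop :=
  exists z, [/\ Gamma z, nth (root T) z (size z).-1 = u &
    [set nth (root T) z (size z).-1; nth (root T) z (size z).-2] = e].

Definition skeleton (T : decoratedTree) (x : T) : Prop :=
  x \in nset T /\ ~ (exists w, [/\ Wset w, Vbar w x & x <> w]).

Definition PS (T : decoratedTree) (p : T * {set T}) : Prop :=
  p \in pairs T /\ skeleton p.1.

(** * Combs *)

Definition third_edge (T : decoratedTree) (u v : T) (f g : {set T}) : Prop :=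
  [/\ g \in nedges T, v \in g, g \notin gamma_edges u v & g != f].

Definition comb_over (T : decoratedTree) (p p' : T * {set T}) : Prop :=
  preceq p' p /\
  forall (v : T) (f : {set T}), (v, f) \in pairs T ->
    prec (v, f) p -> preceq p' (v, f) ->
    [/\ eps v = 2%N \/ eps v = 3%N,
        eps v = 2%N -> Rval v [set f] < 1 &
        eps v = 3%N -> Rval v [set f] = 0 /\
          exists2 g, unique (third_edge p.1 v f) g & tooth v g].

Definition comb_equiv (T : decoratedTree) (p p' : T * {set T}) : Prop :=
  comb_over p p' \/ comb_over p' p.

(* Main.v *)
From mathcomp Require Import all_boot all_order all_algebra.
From mathcomp Require Import ring lra zify.
Require Import Defs.

(** An oriented edge [(u, e)] is determined by the set of cells ahead of it,
and [preceq] becomes inclusion of such branches ([preceqE]).  Two branches that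
meet and miss a common cell are nested, so the pairs that lie between two given
pairs form a chain.  Reflexivity, antisymmetry and transitivity of [preceq],
and the transitivity of being a comb over ([comb_trans]), follow from this;
what remains is to compare two pairs that are related to a common third.

If [x] and [z] are both combs over [y] and are not comparable, the paths from
[x] and [z] towards [y] meet at a vertex [v], entering it by distinct edges.
Since [x] is a comb over [y], the vertex [v] has exactly three neighbours of
positive multiplicity and the edge by which [z] arrives is a tooth.  A tooth
fills its whole branch ([path_in_tooth]), so [z] starts off the skeleton
([comb_join]).

If [x] is a comb over both [y] and [z] and these are not comparable, the paths
towards them part at a vertex [v], and the comb conditions at the two pairs
there say that both ways on are teeth along which [R] vanishes ([comb_split]).
This is impossible for a single tooth already ([tooth_Rval]).  Let [c] be the
characteristic number at [v] along the tooth.  The equation [R = 0] forces the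
weight [Delta] of [v] to be [c - 1], and the definition of a tooth then forces the
weight of its last vertex [t] to lie in the interval from [1 - c] (excluded) to
[0].  The vertices between have weight zero, hence trivial dead-end
decorations, so [d(t) / a_t] is a multiple of [c].  The weight of [t] is
[1 - n / a_t] plus the sum of the defects [n - d_u] over the dicritical
vertices [u] at [t], where [n] is the multiplicity of [t] and each [d_u] is a
divisor of [n] that is at least [a_t * c]; no such choice of numbers falls in
that interval ([end_weight_absurd]).

The arithmetic rests on [n = k_u * d_u] for every dicritical vertex [u] at a
vertex of multiplicity [n] ([mult_dicritical]).  The multiplicities of the two
ends of an edge are combinations of the same two sums, one for each side of the
edge ([mult_edge]), and eliminating one of them brings in the determinant.  The
same elimination shows that a dicritical vertex has no vertex above it
([dicritical_above]); hence the vertices of positive multiplicity are closed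
under paths ([nset_convex]). *)

Set Implicit Arguments.
Unset Strict Implicit.
Unset Printing Implicit Defensive.

Import Order.TTheory GRing.Theory Num.Theory.
Local Open Scope ring_scope.

(** * Paths and branches in a tree *)

Lemma gammaE (T : rootedTree) (x y : T) : exists p,
  [/\ gamma x y = x :: p, path (@adj T) x p, last x p = y & uniq (x :: p)].
Proof. by have [p pE /and3P[? /eqP ? ?]] := gamma_path x y; exists p. Qed.

Lemma gamma_simple (T : rootedTree) (x y : T) (p : seq T) :
  path (@adj T) x p -> last x p = y -> uniq (x :: p) -> gamma x y = x :: p.
Proof. by move=> pp pl pu; apply: gamma_uniq; rewrite /simple_path pl eqxx; apply/andP. Qed.

Lemma gammaxx (T : rootedTree) (x : T) : gamma x x = [:: x].
Proof. exact: gamma_simple. Qed.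

Lemma gamma_adj (T : rootedTree) (x y : T) : adj x y -> gamma x y = [:: x; y].
Proof.
move=> xy; apply: gamma_simple => //=; first by rewrite xy.
by rewrite inE (adj_neq xy).
Qed.

Lemma mem_gammal (T : rootedTree) (x y : T) : x \in gamma x y.
Proof. by have [p [-> _ _ _]] := gammaE x y; rewrite mem_head. Qed.

Lemma mem_gammaC (T : rootedTree) (x y : T) : gamma y x =i gamma x y.
Proof.
have [p [-> pp pl pu]] := gammaE x y.
suff -> : gamma y x = rev (x :: p) by exact: mem_rev.
rewrite lastI rev_rcons pl; apply: gamma_simple.
- by rewrite -pl rev_path; apply: sub_path pp => a b; rewrite adjC.
- by rewrite -pl -(last_cons x) -rev_rcons -lastI rev_cons last_rcons.
- by rewrite -rev_rcons -{1}pl -lastI rev_uniq.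
Qed.

Lemma mem_gammar (T : rootedTree) (x y : T) : y \in gamma x y.
Proof. by rewrite mem_gammaC mem_gammal. Qed.

Lemma gamma_sub (T : rootedTree) (x y : T) (p : seq T) :
  path (@adj T) x p -> last x p = y -> {subset gamma x y <= x :: p}.
Proof.
move=> pp pl; case: (shortenP pp) pl => q qp qu qsub ql a.
rewrite (gamma_simple qp ql qu) !inE => /predU1P[->|/qsub ->]; first by rewrite eqxx.
by rewrite orbT.
Qed.

Lemma gamma_triangle (T : rootedTree) (x y z a : T) :
  a \in gamma x z -> (a \in gamma x y) || (a \in gamma y z).
Proof.
have [p [-> pp pl _]] := gammaE x y; have [q [-> qp ql _]] := gammaE y z.
have pqp : path (@adj T) x (p ++ q) by rewrite cat_path pp pl.
have pql : last x (p ++ q) = z by rewrite last_cat pl.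
move=> /(gamma_sub pqp pql); rewrite !inE mem_cat.
by case: (a == x) => //=; case: (a \in p) => //= ->; rewrite orbT.
Qed.

Lemma gamma_prefix (T : rootedTree) (x y a : T) :
  a \in gamma x y -> {subset gamma x a <= gamma x y}.
Proof.
have [p [-> pp pl pu]] := gammaE x y => ap.
case/splitPl: ap pp {pl pu} => p1 p2 p1l; rewrite cat_path => /andP[p1p _] b.
by move/(gamma_sub p1p p1l); rewrite !inE mem_cat orbA => ->.
Qed.

Lemma gamma_suffix (T : rootedTree) (x y a : T) :
  a \in gamma x y -> {subset gamma a y <= gamma x y}.
Proof.
by rewrite mem_gammaC => ay b; rewrite [b \in gamma a y]mem_gammaC => /(gamma_prefix ay); rewrite mem_gammaC.
Qed.

Lemma gamma_anti (T : rootedTree) (x a b : T) :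
  a \in gamma x b -> b \in gamma x a -> a = b.
Proof.
have [p [-> pp pl pu]] := gammaE x b => ap.
case/splitPl: ap pp pl pu => p1 p2 p1l; rewrite cat_path last_cat p1l => /andP[p1p _] p2l.
rewrite -cat_cons cat_uniq => /and3P[p1u p12 _]; rewrite (gamma_simple p1p p1l p1u) => bp1.
case: p2 p2l p12 => [|c p2] //= p2l /norP[cp1 /hasPn p2P]; case/negP: cp1.
by have := mem_last c p2; rewrite p2l inE => /predU1P[<- //|/p2P /negP].
Qed.

Lemma gamma_mid (T : rootedTree) (x y a b : T) :
  a \in gamma x b -> b \in gamma x y -> b \in gamma a y.
Proof.
move=> axb bxy; case/orP: (gamma_triangle a bxy) => // bxa.
by rewrite (gamma_anti axb bxa) mem_gammal.
Qed.

Lemma in_branch (T : rootedTree) (a b z : T) : (z \in branch a b) = (a \notin gamma b z).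
Proof. by rewrite in_set. Qed.

Lemma branchE (T : rootedTree) (a b z : T) :
  adj a b -> (z \in branch a b) = (b \in gamma a z).
Proof.
move=> ab; rewrite in_branch; apply/idP/idP => [azb|bza].
  have [p [pE pp pl pu]] := gammaE b z; rewrite pE in azb.
  rewrite (@gamma_simple _ a z (b :: p)) ?inE ?eqxx ?orbT //=.
    by rewrite ab pp.
  by rewrite azb.
apply/negP => abz; move/adj_neq: ab; rewrite (_ : a = b) ?eqxx //.
by apply: (@gamma_anti _ z); rewrite mem_gammaC.
Qed.

Lemma branchC (T : rootedTree) (a b : T) : adj a b -> branch b a = ~: branch a b.
Proof. by move=> ab; apply/setP => z; rewrite [RHS]inE branchE 1?adjC // in_branch negbK. Qed.

Lemma branchx (T : rootedTree) (a b : T) : a \notin branch a b.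
Proof. by rewrite in_branch mem_gammar. Qed.

Lemma branch_in (T : rootedTree) (a b : T) : adj a b -> b \in branch a b.
Proof. by move=> ab; rewrite inE gammaxx inE adj_neq. Qed.

Lemma gamma_cons (T : rootedTree) (x y z : T) :
  adj x y -> z \in branch x y -> gamma x z = x :: gamma y z.
Proof.
move=> xy; have [p [pE pp pl pu]] := gammaE y z; rewrite in_branch pE => xp.
by apply: gamma_simple => //=; rewrite ?xy ?xp.
Qed.

Lemma first_step (T : rootedTree) (x z : T) :
  x != z -> exists2 y, adj x y & z \in branch x y.
Proof.
have [[|y p] [pE pp pl pu]] := gammaE x z; first by rewrite -pl eqxx.
move=> _; case/andP: pp => xy _; exists y => //.
by rewrite branchE // pE !inE eqxx orbT.
Qed.

Lemma first_step_uniq (T : rootedTree) (x y y' z : T) :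
  adj x y -> adj x y' -> z \in branch x y -> z \in branch x y' -> y = y'.
Proof.
move=> xy xy' zy zy'; have := gamma_cons xy zy; rewrite (gamma_cons xy' zy').
by have [p [-> _ _ _]] := gammaE y z; have [q [-> _ _ _]] := gammaE y' z => -[].
Qed.

Lemma branch_step (T : rootedTree) (a b c d : T) :
  c \in branch a b -> adj c d -> d != a -> d \in branch a b.
Proof.
move=> cB cd da; have ca : c != a by apply: contraTneq cB => ->; exact: branchx.
move: cB; rewrite !in_branch; apply: contraNN => /(gamma_triangle c).
by rewrite (gamma_adj cd) !inE ![a == _]eq_sym (negPf da) (negPf ca) !orbF.
Qed.

Lemma branch_cross (T : rootedTree) (a b s z : T) :
  s \in branch a b -> z \notin branch a b -> a \in gamma s z.
Proof.
rewrite !in_branch negbK => abs /(gamma_triangle s); by rewrite (negPf abs).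
Qed.

(** Two branches that meet are nested as soon as the foot of one lies outside
the other: leaving the outer branch forces a path through its foot. *)
Lemma branch_sub (T : rootedTree) (a b v w s : T) :
  s \in branch v w -> s \in branch a b -> a \notin branch v w ->
  branch v w \subset branch a b.
Proof.
move=> svw sab avw; apply/subsetP => z zvw; apply: contraNT avw => zab.
have asz := branch_cross sab zab.
move: svw zvw; rewrite !in_branch => svw zvw; apply/negP => /(gamma_triangle s).
rewrite (negPf svw) /= => /(gamma_prefix asz) /(gamma_triangle w).
by rewrite (negPf zvw) mem_gammaC (negPf svw).
Qed.

Lemma branch_inj (T : rootedTree) (a b v w : T) :
  adj a b -> adj v w -> branch a b = branch v w -> a = v /\ b = w.
Proof.
have foot (a' b' v' w' : T) : adj a' b' -> branch a' b' = branch v' w' -> v' = a'.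
  move=> ab E.
  have := @branch_cross _ v' w' b' a'; rewrite -E branch_in // branchx.
  rewrite gamma_adj 1?adjC // !inE => /(_ isT isT) /orP[] /eqP // v'b.
  by move: (branch_in ab); rewrite E -v'b (negPf (branchx _ _)).
move=> ab vw E; split; first by rewrite (foot _ _ _ _ ab E).
by rewrite (foot b a w v) 1?adjC ?(branchC ab) ?(branchC vw) ?E.
Qed.

(** Otherwise the foot of each branch lies in the other one, and a path from [o]
to either foot passes through the other foot first. *)
Lemma branch_nested (T : rootedTree) (a b v w s o : T) :
  adj a b -> adj v w -> s \in branch a b -> s \in branch v w ->
  o \notin branch a b -> o \notin branch v w ->
  branch a b \subset branch v w \/ branch v w \subset branch a b.
Proof.
move=> ab vw sab svw oab ovw.
have [avw|avw] := boolP (a \in branch v w); last by right; exact: branch_sub svw sab avw.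
have [vab|vab] := boolP (v \in branch a b); last by left; exact: branch_sub sab svw vab.
have E : a = v.
  by apply: (@gamma_anti _ o); rewrite mem_gammaC; apply: branch_cross; eauto.
by rewrite E (negPf (branchx _ _)) in avw.
Qed.

Lemma path_edges_cons (X : finType) (x y : X) (s : seq X) :
  path_edges (x :: y :: s) = [set x; y] :: path_edges (y :: s).
Proof. by []. Qed.

Lemma mem_path_edges (X : finType) (s : seq X) (v w : X) :
  [set v; w] \in path_edges s -> v \in s /\ w \in s.
Proof.
elim: s => [|x [|y s] IH] //; rewrite path_edges_cons inE => /predU1P[E|/IH[vs ws]].
  have vE : v \in [set x; y] by rewrite -E set21.
  have wE : w \in [set x; y] by rewrite -E set22.
  by split; [case/set2P: vE | case/set2P: wE] => ->; rewrite !inE eqxx ?orbT.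
by split; rewrite in_cons ?vs ?ws orbT.
Qed.

(** A path without repetition has no room for another cell between two adjacent ones. *)
Lemma gamma_edgesE (T : rootedTree) (v w x y : T) : adj v w ->
  ([set v; w] \in gamma_edges x y) = (v \in gamma x y) && (w \in gamma x y).
Proof.
move=> vw; apply/idP/andP => [/mem_path_edges //|[]]; rewrite /gamma_edges.
have [p [-> pp pl pu]] := gammaE x y.
have next (a b c : T) q : path (@adj T) a (c :: q) -> uniq (a :: c :: q) ->
    adj a b -> b \in c :: q -> b = c.
  move=> qp qu ab bq; have E := gamma_simple qp erefl qu.
  have ac : adj a c by case/andP: qp.
  apply: (@first_step_uniq _ a b c (last a (c :: q))) => //.
    by rewrite branchE // E inE bq orbT.
  by rewrite branchE // E !inE eqxx orbT.
elim: p x pp pu {pl} => [|c p IH] x pp pu vp wp.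
  by move/adj_neq: vw; rewrite !inE in vp wp; rewrite (eqP vp) (eqP wp) eqxx.
rewrite path_edges_cons inE; move: vp wp; rewrite !(in_cons x).
have [vx _|vx /= vp] := eqVneq v x.
  rewrite vx in vw *; rewrite eq_sym (negPf (adj_neq vw)) /= => wp.
  by rewrite (next x w c p pp pu) ?eqxx.
have [wx _|wx /= wp] := eqVneq w x.
  rewrite wx adjC in vw *; rewrite setUC.
  by rewrite (next x v c p pp pu) ?eqxx.
by rewrite IH ?orbT //; [case/andP: pp | case/andP: pu].
Qed.

(** * The order from the root, leaves and inner cells *)

Lemma gamma_inner (T : rootedTree) (x y c : T) :
  c \in gamma x y -> c != x -> c != y ->
  exists a b, [/\ adj c a, adj c b, a != b, a \in gamma x y & b \in gamma x y].
Proof.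
move=> cxy cx cy; have [a ca xa] := first_step cx; have [b cb yb] := first_step cy.
exists a, b; split=> //.
- apply: contraL cxy => /eqP ab; subst b; apply/negP => /(gamma_triangle a).
  by rewrite mem_gammaC; move: xa yb; rewrite !in_branch => /negPf -> /negPf ->.
- by apply: (gamma_prefix cxy); rewrite mem_gammaC -branchE.
- by apply: (gamma_suffix cxy); rewrite -branchE.
Qed.

Lemma arrow_adj (T : rootedTree) (c a b : T) :
  c \in arrows T -> adj c a -> adj c b -> a = b.
Proof.
rewrite !inE => /andP[_ /cards1P[e eP]] ca cb.
have /eqP E : [set c; a] == [set c; b].
  have mem d : adj c d -> [set c; d] = e.
    by move=> cd; apply/set1P; rewrite -eP !inE eqxx andbT.
  by rewrite !mem.
move/setP/(_ a): E; rewrite !inE eqxx orbT; have := adj_neq ca.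
by rewrite eq_sym => /negPf -> /esym/eqP.
Qed.

Lemma inner_vertex (T : rootedTree) (x y c : T) :
  c \in gamma x y -> c != x -> c != y -> c \in vertices T.
Proof.
move=> cxy cx cy; have [a [b [ca cb ab _ _]]] := gamma_inner cxy cx cy.
by rewrite inE; apply: contraNN ab => /arrow_adj/(_ ca cb) ->.
Qed.

Lemma root_vertex (T : rootedTree) : root T \in vertices T.
Proof. by rewrite !inE eqxx. Qed.

Lemma below_vertex (T : rootedTree) (x y : T) : below x y -> x \in vertices T.
Proof.
case/andP=> xy xry; have [->|xr] := eqVneq x (root T); first exact: root_vertex.
exact: inner_vertex xry xr xy.
Qed.

Lemma belowE (T : rootedTree) (x y : T) : adj x y -> below x y = (root T \notin branch x y).
Proof.
by move=> xy; rewrite /below (adj_neq xy) in_branch negbK mem_gammaC.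
Qed.

Lemma adj_below (T : rootedTree) (x y : T) : adj x y -> below x y || below y x.
Proof. move=> xy; have yx : adj y x by rewrite adjC.
by rewrite !belowE // (branchC xy) in_setC negbK orNb. Qed.

Lemma parent_uniq (T : rootedTree) (x y u : T) :
  adj x u -> adj y u -> below x u -> below y u -> x = y.
Proof.
move=> xu yu; rewrite !belowE // => rx ry.
by apply: (@first_step_uniq _ u x y (root T)); rewrite 1?adjC ?(branchC xu) ?(branchC yu) ?in_setC.
Qed.

Lemma edge_end (T : rootedTree) (e : {set T}) (u : T) :
  e \in edges T -> u \in e -> exists2 c, adj u c & e = [set u; c].
Proof.
move=> eE ue; have := card_edge eE; rewrite (cardsD1 u) ue => -[] /eqP/cards1P[c cE].
have E : e = [set u; c] by rewrite -(setD1K ue) cE.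
by exists c => //; rewrite /adj /adjacent_in -E.
Qed.

Lemma up_edgeE (T : decoratedTree) (v x : T) : adj v x -> below v x -> [set v; x] \in up_edges v.
Proof. by move=> vx bvx; rewrite inE [_ \in edges T]vx; apply/existsP; exists x; rewrite eqxx. Qed.

(** * Multiplicities across an edge *)

(** For [z] beyond the edge from [x] to [y], this is the factor common to
[xval x z] and [xval y z]. *)
Definition xtail (T : decoratedTree) (x y z : T) : int :=
  \prod_(u <- gamma y z)
    \prod_(e in edges T | (u \in e) && (e \notin gamma_edges x z)) deco e u.

Definition flux (T : decoratedTree) (x y : T) : int :=
  \sum_(z in arrows1 T | z \in branch x y) xtail x y z.

Lemma gamma_edges_cons (T : rootedTree) (x y z : T) : adj x y -> z \in branch x y ->
  gamma_edges x z = [set x; y] :: gamma_edges y z.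
Proof.
move=> xy zxy; rewrite /gamma_edges (gamma_cons xy zxy).
by have [p [-> _ _ _]] := gammaE y z.
Qed.

Lemma gamma_edges_mem (T : rootedTree) (x y c : T) (e : {set T}) :
  e \in gamma_edges x y -> c \in e -> c \in gamma x y.
Proof.
case/mapP=> -[a b] /= ab ->.
have [aP bP] : a \in gamma x y /\ b \in gamma x y.
  by apply: mem_path_edges; apply/mapP; exists (a, b).
by rewrite !inE => /orP[] /eqP ->.
Qed.

Lemma xval_near (T : decoratedTree) (x y z : T) : adj x y -> z \in branch x y ->
  xval x z = codeco [set x; y] x * xtail x y z.
Proof.
move=> xy zxy; rewrite /xval {1}(gamma_cons xy zxy) big_cons; congr (_ * _).
apply: eq_bigl => e; case: (e \in edges T) => //=; rewrite andbC.
case xe: (x \in e); last by rewrite !andbF.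
rewrite (gamma_edges_cons xy zxy) inE negb_or !andbT.
have -> : e \notin gamma_edges y z; last by rewrite andbT.
by apply: contraL zxy => /gamma_edges_mem/(_ xe) xyz; rewrite in_branch xyz.
Qed.

Lemma xval_far (T : decoratedTree) (x y z : T) : adj x y -> z \in branch x y ->
  xval y z = deco [set x; y] y * xtail x y z.
Proof.
move=> xy zxy; rewrite /xval /xtail.
have [p [pE pp _ pu]] := gammaE y z; rewrite pE !big_cons mulrA; congr (_ * _).
  rewrite (bigD1 [set x; y]) /=; last first.
    rewrite [_ \in edges T]xy !inE eqxx orbT /=.
    apply: contraL zxy => /gamma_edges_mem xyz.
    by rewrite in_branch xyz // !inE eqxx.
  congr (_ * _); apply: eq_bigl => e; rewrite (gamma_edges_cons xy zxy) inE negb_or.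
  by rewrite -!andbA [(e \notin _) && _]andbC.
rewrite [LHS]big_seq [RHS]big_seq; apply: eq_bigr => u up; apply: eq_bigl => e.
rewrite (gamma_edges_cons xy zxy) inE negb_or.
case ue: (u \in e) => //=; suff -> : e != [set x; y] by [].
apply: contraTneq ue => ->; rewrite !inE negb_or; apply/andP; split.
  by apply: contraTneq zxy => <-; rewrite in_branch pE negbK inE up orbT.
by apply: contraTneq up => ->; case/andP: pu.
Qed.

(** The paths from [x] split into those that cross the edge to [y] and those
that do not.  Applied to both ends, this expresses two multiplicities by the
same two fluxes. *)
Lemma mult_edge (T : decoratedTree) (x y : T) : adj x y ->
  mult x = codeco [set x; y] x * flux x y + deco [set x; y] x * flux y x.
Proof.
move=> xy; have yx : adj y x by rewrite adjC.
rewrite /mult (bigID (mem (branch x y))) /=; congr (_ + _); rewrite /flux big_distrr /=.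
  by apply: eq_bigr => z /andP[_]; exact: xval_near.
apply: eq_big => [z|z /andP[_ zxy]]; first by rewrite (branchC xy) in_setC.
by rewrite setUC (xval_far yx) // (branchC xy) in_setC.
Qed.

(** * Consequences of the axioms on decorations *)

Lemma arrow1_above (T : decoratedTree) (v : T) : newton_tree_at_infinity T ->
  v \in vertices T -> exists2 x, x \in arrows1 T & below v x.
Proof. by case=> + _; apply. Qed.

Lemma deco_up (T : decoratedTree) (v : T) (e : {set T}) : newton_tree_at_infinity T ->
  v \in vertices T -> e \in up_edges v -> 1 <= deco e v.
Proof. by case=> [_ [_ [_ [_ [H _]]]]] /H[_ + _ _]; apply. Qed.

Lemma deco_arrow (T : decoratedTree) (x : T) (e : {set T}) : newton_tree_at_infinity T ->
  e \in edges T -> x \in arrows T -> x \in e -> deco e x = 1.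
Proof. by case=> [_ [_ [_ [+ _]]]]; apply. Qed.

Lemma deco_gt0 (T : decoratedTree) (u c : T) : newton_tree_at_infinity T ->
  adj u c -> below u c || (u \in arrows T) -> 0 < deco [set u; c] u.
Proof.
move=> hN uc; have [ua _|uv] := boolP (u \in arrows T).
  by rewrite deco_arrow // !inE eqxx.
rewrite orbF => buc; apply: lt_le_trans (deco_up hN _ (up_edgeE uc buc)) => //.
by rewrite inE.
Qed.

Lemma off_path_above (T : rootedTree) (x u c : T) :
  adj u c -> u \in gamma (root T) x -> c \notin gamma (root T) x -> below u c.
Proof.
move=> uc ux; apply: contraNT; rewrite belowE // negbK branchE //.
by rewrite [c \in gamma u _]mem_gammaC => /(gamma_prefix ux).
Qed.

Lemma xtail_gt0 (T : decoratedTree) (x y z : T) : newton_tree_at_infinity T ->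
  adj x y -> below x y -> z \in branch x y -> 0 < xtail x y z.
Proof.
move=> hN xy; rewrite belowE // => rxy zxy.
have xrz : x \in gamma (root T) z by rewrite mem_gammaC (branch_cross zxy).
rewrite /xtail big_seq; apply: prodr_gt0 => u uyz; apply: prodr_gt0 => e /and3P[eE ue].
have uxz : u \in gamma x z by rewrite (gamma_cons xy zxy) in_cons uyz orbT.
have [c uc ->] := edge_end eE ue; rewrite gamma_edgesE // uxz /= => cxz.
apply: deco_gt0 => //; rewrite (@off_path_above _ z u c) //.
  exact: gamma_suffix uxz.
apply: contra cxz => crz; case/orP: (gamma_triangle x crz) => // crx.
have [-> |cx] := eqVneq c x; first exact: mem_gammal.
have uB : u \in branch x y.
  by move: zxy; rewrite !in_branch; apply: contraNN; exact: gamma_prefix.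
have := branch_cross (branch_step uB uc cx) rxy; rewrite mem_gammaC => xrc.
by case/eqP: cx; exact: gamma_anti crx xrc.
Qed.

Lemma flux_gt0 (T : decoratedTree) (x y : T) : newton_tree_at_infinity T ->
  adj x y -> below x y -> y \in vertices T -> 0 < flux x y.
Proof.
move=> hN xy bxy yV; have [z zA /andP[_ yrz]] := arrow1_above hN yV.
have zxy : z \in branch x y by rewrite branchE // (gamma_mid _ yrz) //; case/andP: bxy.
rewrite /flux (bigD1 z) /=; last by rewrite zA.
apply: ltr_pwDl; first exact: xtail_gt0.
by apply: sumr_ge0 => z' /andP[/andP[_ ?] _]; exact/ltW/xtail_gt0.
Qed.

Lemma edge_det2 (T : decoratedTree) (x y : T) : adj x y -> edge_det [set x; y] =
  deco [set x; y] x * deco [set x; y] y - codeco [set x; y] x * codeco [set x; y] y.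
Proof.
by move=> xy; rewrite /edge_det !big_setU1 ?big_set1 ?inE ?adj_neq.
Qed.

Lemma edge_det_lt0 (T : decoratedTree) (x y : T) : newton_tree_at_infinity T ->
  adj x y -> x \in vertices T -> y \in vertices T -> edge_det [set x; y] < 0.
Proof.
case=> [_ [_ [_ [_ [_ H]]]]] xy xV yV; apply: H => //.
by apply/subsetP => z; rewrite !in_set2 => /orP[] /eqP ->.
Qed.

Lemma arrows1_arrows (T : decoratedTree) (x : T) : x \in arrows1 T -> x \in arrows T.
Proof. by rewrite inE => /andP[]. Qed.

Lemma dead_endP (T : decoratedTree) (v : T) (e : {set T}) :
  e \in dead_ends T -> v \in e -> v \in vertices T ->
  exists x, [/\ x \in arrows0 T, adj v x, below v x & e = [set v; x]].
Proof.
rewrite inE => /andP[eE /existsP[x /andP[xA xe]]] ve vV.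
have xa : x \in arrows T by move: xA; rewrite inE => /andP[].
have xv : x != v by apply: contraTneq vV => <-; rewrite inE negbK.
have [c vc E] := edge_end eE ve.
have cx : c = x by move: xe; rewrite E !inE (negPf xv) => /eqP.
exists x; split=> //; rewrite -cx //; case/orP: (adj_below vc) => // /below_vertex.
by rewrite cx inE xa.
Qed.

Lemma aval_ge1 (T : decoratedTree) (v : T) : newton_tree_at_infinity T ->
  v \in vertices T -> 1 <= aval v.
Proof.
move=> hN vV; rewrite /aval; case: pickP => [e /andP[eD ve]|_] //.
have [x [_ vx bvx ->]] := dead_endP eD ve vV.
exact: deco_up hN vV (up_edgeE vx bvx).
Qed.

(** * Dicritical vertices *)

(** Otherwise, eliminating one flux across the edge would make the multiplicity
of the upper end [w], up to a positive factor, the product of a positive flux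
and the negative determinant. *)
Lemma dicritical_above (T : decoratedTree) (u w : T) :
  newton_tree_at_infinity T -> minimally_complete T ->
  u \in dicriticals T -> adj u w -> w \in vertices T -> below w u.
Proof.
move=> hN [[hpos _] _]; rewrite inE => /andP[uV /eqP u0] uw wV.
case/orP: (adj_below uw) => // buw; exfalso.
have := mult_edge uw; rewrite u0; have := mult_edge (etrans (adjC w u) uw); rewrite setUC.
have := edge_det_lt0 hN uw uV wV; rewrite edge_det2 //.
have := deco_gt0 hN uw; rewrite buw => /(_ isT).
have := flux_gt0 hN uw buw wV; have := hpos _ wV.
move: (mult w) (flux u w) (flux w u) (deco _ u) (deco _ w) (codeco _ u) (codeco _ w).
move=> N S S' q q' Q Q' N0 S0 q0 det EN E0.
have : q * N = (q * q' - Q * Q') * S.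
  have -> : q * N = q * (Q' * S' + q' * S) - Q' * (Q * S + q * S') by rewrite -E0 mulr0 subr0 EN.
  by ring.
have : (q * q' - Q * Q') * S < 0 by rewrite nmulr_rlt0.
by move=> /[swap] <-; rewrite ltNge mulr_ge0 // ltW.
Qed.

Lemma dicritical_leaf (T : decoratedTree) (u v w : T) :
  newton_tree_at_infinity T -> minimally_complete T ->
  u \in dicriticals T -> adj u v -> adj u w -> v \in vertices T -> w \in vertices T -> v = w.
Proof.
move=> hN hm uD uv uw vV wV.
by apply: (@parent_uniq _ v w u); rewrite 1?adjC //; apply: dicritical_above.
Qed.

Lemma deco_dicritical_arrow (T : decoratedTree) (u x : T) :
  newton_tree_at_infinity T -> minimally_complete T ->
  u \in dicriticals T -> x \in arrows1 T -> adj u x -> deco [set u; x] u = 1.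
Proof.
move=> hN [_ [hdead _]] uD xA ux.
have uV : u \in vertices T by move: uD; rewrite inE => /andP[].
have bux : below u x.
  by case/orP: (adj_below ux) => // /below_vertex; rewrite inE arrows1_arrows.
have uxup := up_edgeE ux bux.
apply: le_anti; rewrite (deco_up hN uV uxup) andbT leNgt; apply/negP => gt1.
have [e eD ue] := hdead _ uD; have [y [yA uy buy E]] := dead_endP eD ue uV.
have [_ [_ [_ [_ [H _]]]]] := hN; have [_ _ Hone Hmax] := H _ uV.
have eup : e \in up_edges u by rewrite E up_edgeE.
have gt1' : 1 < deco e u.
  by rewrite (Hmax e) //; apply: (lt_le_trans gt1); exact: (le_bigmax_cond _ (fun f => deco f u)).
have := Hone _ _ uxup eup gt1 gt1'; rewrite E => /setP/(_ x).
rewrite !inE eqxx orbT eq_sym (negPf (adj_neq ux)) => /esym/eqP xy.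
by move: xA; rewrite inE xy yA.
Qed.

Lemma codeco_parent_gt0 (T : decoratedTree) (v u : T) : newton_tree_at_infinity T ->
  adj v u -> below v u -> 0 < codeco [set v; u] u.
Proof.
move=> hN vu bvu; apply: prodr_gt0 => e /and3P[eE ne ue].
have [c uc E] := edge_end eE ue; subst e; apply: deco_gt0 => //.
case/orP: (adj_below uc) => [-> //|bcu]; case/eqP: ne.
by rewrite setUC (parent_uniq _ vu bcu bvu) // adjC.
Qed.

Lemma flux_dicritical (T : decoratedTree) (v u : T) :
  newton_tree_at_infinity T -> minimally_complete T ->
  u \in dicriticals T -> adj v u -> v \in vertices T ->
  flux v u = codeco [set v; u] u * (degree u)%:Z.
Proof.
move=> hN hm uD vu vV; have uv : adj u v by rewrite adjC.
have bvu := dicritical_above hN hm uD uv vV.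
have arrow z : (z \in arrows1 T) && (z \in branch v u) = (z \in [set x in arrows1 T | adj u x]).
  rewrite inE; case zA: (z \in arrows1 T) => //=; apply/idP/idP => [zB|uz].
    have uz : u != z.
      apply: contraTneq uD => ->; rewrite inE /vertices inE arrows1_arrows //.
    have [c uc zc] := first_step uz; have [<- //|cz] := eqVneq c z.
    have cV : c \in vertices T.
      apply: (@inner_vertex _ u z) => //; first by rewrite -branchE.
      by rewrite eq_sym adj_neq.
    have cv : c = v by apply: dicritical_leaf hN hm uD uc uv cV vV.
    by move: zc; rewrite cv branchC // inE zB.
  rewrite in_branch gamma_adj // !inE negb_or adj_neq //=.
  by apply: contraTneq vV => ->; rewrite inE negbK arrows1_arrows.
rewrite /flux (eq_bigl _ _ arrow) (eq_bigr (fun=> codeco [set v; u] u)) => [|z].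
  by rewrite sumr_const -mulr_natr natz.
rewrite -arrow => /andP[zA zB].
have uz : adj u z by have := arrow z; rewrite zA zB inE zA /= => <-.
have za := arrows1_arrows zA.
have ge : gamma_edges v z = [:: [set v; u]; [set u; z]].
  by rewrite (gamma_edges_cons vu zB) /gamma_edges (gamma_adj uz).
rewrite /xtail (gamma_adj uz) !big_cons big_nil mulr1 ge [X in _ * X]big1 ?mulr1 => [|e].
  rewrite /codeco [RHS](bigD1 [set u; z]) /=; last first.
    rewrite [_ \in edges T]uz !inE eqxx andbT /=; apply: contraTneq zB => /setP/(_ z).
    rewrite set22 => /esym/set2P[zv|zu]; first by rewrite zv branchx.
    by have := adj_neq uz; rewrite zu eqxx.
  rewrite (deco_dicritical_arrow hN hm) // mul1r; apply: eq_bigl => e.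
  rewrite !inE negb_or; case: (e \in edges T) => //=.
  by case: (u \in e); rewrite /= ?andbT ?andbF.
case/and3P=> eE ze; have [c zc ->] := edge_end eE ze.
by rewrite (arrow_adj za zc (etrans (adjC z u) uz)) setUC !inE eqxx orbT.
Qed.

(** Eliminating the two fluxes across the edge between [v] and a dicritical
vertex [u], where the multiplicity vanishes, leaves minus the determinant of
the edge times the number of arrows at [u]. *)
Lemma mult_dicritical (T : decoratedTree) (v u : T) :
  newton_tree_at_infinity T -> minimally_complete T ->
  u \in dicr_at v -> v \in vertices T ->
  mult v = kval u * (degree u)%:Z /\ 1 <= kval u.
Proof.
move=> hN hm; rewrite inE => /andP[uD vu] vV; have uv : adj u v by rewrite adjC.
have uV : u \in vertices T by move: uD; rewrite inE => /andP[].
have kE : kval u = - edge_det [set u; v].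
  rewrite /kval; case: pickP => [w /andP[wV uw]|/(_ v)]; last by rewrite vV uv.
  by rewrite (dicritical_leaf hN hm uD uw uv wV vV).
have det := edge_det_lt0 hN uv uV vV; split; last by rewrite kE -gtz0_ge1 oppr_gt0.
have := mult_edge uv; have := mult_edge vu.
have -> : mult u = 0 by move: uD; rewrite inE => /andP[_ /eqP].
rewrite (flux_dicritical hN hm uD vu vV) kE edge_det2 // (setUC [set v]).
have := codeco_parent_gt0 hN vu (dicritical_above hN hm uD uv vV); rewrite (setUC [set v]).
move: (mult v) (flux u v) (deco _ u) (deco _ v) (codeco _ u) (codeco _ v) (degree u)%:Z.
move=> N S q q' Q Q' d Q0 -> E.
have {E} SE : S = - (q * d).
  by apply: (mulfI (lt0r_neq0 Q0)); apply/eqP; rewrite -subr_eq0; apply/eqP; rewrite [RHS]E; ring.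
by rewrite SE; ring.
Qed.

(** * The subtree of vertices of positive multiplicity *)

Lemma nset_vertex (T : decoratedTree) (v : T) : v \in nset T -> v \in vertices T.
Proof. by rewrite inE => /andP[]. Qed.

(** Paths between vertices of positive multiplicity avoid the dicritical
vertices, which are leaves of the tree of vertices. *)
Lemma nset_convex (T : decoratedTree) (x y c : T) :
  newton_tree_at_infinity T -> minimally_complete T ->
  x \in nset T -> y \in nset T -> c \in gamma x y -> c \in nset T.
Proof.
move=> hN hm xN yN cxy.
have [-> //|cx] := eqVneq c x; have [-> //|cy] := eqVneq c y.
have inV a : a \in gamma x y -> a \in vertices T.
  move=> axy; have [->|ax] := eqVneq a x; first exact: nset_vertex.
  by have [->|ay] := eqVneq a y; [exact: nset_vertex | exact: inner_vertex axy ax ay].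
have [a [b [ca cb ab /inV aV /inV bV]]] := gamma_inner cxy cx cy.
have cV := inV _ cxy; rewrite inE cV lt_def; have [[hpos _] _] := hm.
rewrite hpos // andbT; apply: contra ab => c0; apply/eqP.
by apply: dicritical_leaf hN hm _ ca cb aV bV; rewrite inE cV.
Qed.

Lemma rvalE (T : decoratedTree) (v : T) : minimally_complete T ->
  rval v = - 1 + (#|dicr_at v| + eps v)%:Z.
Proof.
move=> [[hpos _] _]; rewrite /rval; congr (_ + Posz _).
rewrite -(cardsID (dicriticals T)) /eps; congr (_ + _)%N; apply: eq_card => x.
  by rewrite !(in_setI, in_set); case: (adj v x); rewrite ?andbF ?andbT //= andbA andbb.
rewrite in_setD [x \in dicriticals T]in_set [x \in neighbours v]in_set [x \in nset T]in_set.
rewrite [x \in [set _ in vertices T | _]]in_set lt_def; have := hpos x.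
case: (x \in vertices T) => /= [/(_ isT) ->|_] //.
by rewrite andbT.
Qed.

(** * Weights of vertices and teeth *)

Lemma mult_gt0 (T : decoratedTree) (v : T) : v \in nset T -> 0 < (mult v)%:~R :> rat.
Proof. by rewrite inE ltr0z => /andP[]. Qed.

Lemma aval_ge1q (T : decoratedTree) (v : T) : newton_tree_at_infinity T ->
  v \in nset T -> 1 <= (aval v)%:~R :> rat.
Proof. by move=> hN /nset_vertex vV; rewrite (ler_int _ 1) aval_ge1. Qed.

Lemma degree_dicritical (T : decoratedTree) (v u : T) :
  newton_tree_at_infinity T -> minimally_complete T -> v \in nset T -> u \in dicr_at v ->
  [/\ 1 <= (kval u)%:~R :> rat, 0 < (degree u)%:R :> rat,
      (mult v)%:~R = (kval u)%:~R * (degree u)%:R :> rat &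
      kval u = 1 \/ 2 <= (kval u)%:~R :> rat].
Proof.
move=> hN hm vN uD; have [nE k1] := mult_dicritical hN hm uD (nset_vertex vN).
have nQ : (mult v)%:~R = (kval u)%:~R * (degree u)%:R :> rat.
  by rewrite nE intrM.
have k1q : 1 <= (kval u)%:~R :> rat by rewrite (ler_int _ 1).
split=> //.
  by have := mult_gt0 vN; rewrite nQ pmulr_rgt0 // (lt_le_trans _ k1q).
have [->|kn1] := eqVneq (kval u) 1; [by left|right].
by rewrite (ler_int _ 2) -[2]/(1 + 1) lezD1 lt_def kn1.
Qed.

Lemma DeltaE (T : decoratedTree) (v : T) : minimally_complete T ->
  Delta v = ((eps v)%:R - 2) * ((mult v)%:~R - 1)
    + (mult v)%:~R * (1 - 1 / (aval v)%:~R)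
    + \sum_(u in dicr_at v) ((mult v)%:~R - (degree u)%:R).
Proof.
move=> hm; rewrite /Delta rvalE // !sumrB !sumr_const PoszD !intrD -!pmulrn.
rewrite -[(mult v)%:~R *+ _]mulr_natr.
move: (\sum_(i in _) _) => S; set n : rat := (mult v)%:~R.
ring.
Qed.

Lemma degree_le_mult (T : decoratedTree) (v u : T) :
  newton_tree_at_infinity T -> minimally_complete T -> v \in nset T -> u \in dicr_at v ->
  0 <= (mult v)%:~R - (degree u)%:R :> rat.
Proof.
move=> hN hm vN uD; have [k1 d0 -> _] := degree_dicritical hN hm vN uD.
by rewrite subr_ge0 ler_peMl // ltW.
Qed.

Lemma inner_aval (T : decoratedTree) (v : T) :
  newton_tree_at_infinity T -> minimally_complete T -> v \in nset T ->
  eps v = 2%N -> Delta v = 0 -> (aval v)%:~R = 1 :> rat.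
Proof.
move=> hN hm vN e2; rewrite DeltaE // e2 subrr mul0r add0r => /eqP.
have n0 := mult_gt0 vN; have a1 := aval_ge1q hN vN.
have S0 : 0 <= \sum_(u in dicr_at v) ((mult v)%:~R - (degree u)%:R) :> rat.
  by apply: sumr_ge0 => u; exact: degree_le_mult.
have b0 : 0 <= 1 - 1 / (aval v)%:~R :> rat.
  by rewrite subr_ge0 div1r invf_le1 // (lt_le_trans ltr01).
rewrite paddr_eq0 ?mulr_ge0 // ?(ltW n0) // => /andP[+ _].
rewrite mulf_eq0 gt_eqF //= subr_eq0 div1r eq_sym invr_eq1 => /eqP //.
Qed.

(** Multiplied by the multiplicity, the terms of [R] other than the one at [f]
are the terms of [Delta] that come from the dicritical vertices and the dead
end; so [R = 0] trades them for the characteristic number. *)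
Lemma Delta_of_Rval0 (T : decoratedTree) (v : T) (f : {set T}) :
  newton_tree_at_infinity T -> minimally_complete T -> v \in nset T ->
  eps v = 3%N -> Rval v [set f] = 0 -> Delta v = charnum v f - 1.
Proof.
move=> hN hm vN e3; rewrite DeltaE // e3 /Rval big_set1 /Mval; have n0 := mult_gt0 vN.
move=> R0; have : (mult v)%:~R * 0 = 0 :> rat by rewrite mulr0.
rewrite -{1}R0 !mulrDr big_distrr /=.
rewrite (eq_bigr (fun u => (mult v)%:~R - (degree u)%:R)) => [|u uD]; last first.
  have [k1 d0 -> _] := degree_dicritical hN hm vN uD.
  have k0 : (kval u)%:~R != 0 :> rat by rewrite gt_eqF // (lt_le_trans ltr01).
  by field.
have -> : (mult v)%:~R * - (1 / ((mult v)%:~R / charnum v f)) = - charnum v f.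
  by rewrite div1r invf_div mulrN mulrCA divff ?mulr1 // gt_eqF.
rewrite -[3%:R]/(3 : rat); lra.
Qed.

Lemma neighbours2 (T : decoratedTree) (v w y : T) : adj v w -> adj w y -> v != y ->
  v \in nset T -> y \in nset T -> eps w = 2%N -> neighbours w :\ v = [set y].
Proof.
move=> vw wy vy vN yN e2; have vnb : v \in neighbours w by rewrite in_set vN adjC.
have c1 : #|neighbours w :\ v| = 1%N.
  by move: e2; rewrite /eps (cardsD1 v) vnb => -[].
by apply/esym/eqP; rewrite eqEcard c1 cards1 leqnn andbT sub1set in_setD1 eq_sym vy in_set yN.
Qed.

(** Along a chain of vertices of weight zero every dead-end decoration is 1, so
the successive gcds are taken without division, and each one divides the
contribution of the last vertex of the chain. *)
Lemma charnum_chain (T : decoratedTree) (v w : T) (s : seq T) :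
  newton_tree_at_infinity T -> minimally_complete T ->
  path (@adj T) v (w :: s) -> uniq (v :: w :: s) -> {subset v :: w :: s <= nset T} ->
  (forall j, (j < size s)%N -> eps (nth (root T) (w :: s) j) = 2%N /\
     Delta (nth (root T) (w :: s) j) = 0) ->
  eps (last w s) = 1%N ->
  exists m : int, (dval (last w s))%:~R / (aval (last w s))%:~R
    = m%:~R * charnum v [set v; w].
Proof.
move=> hN hm; elim: s v w => [|y s IH] v w p u sub inner e1.
  have /andP[vw _] := p.
  by exists 1; rewrite charnumE // [eps w]e1 eqxx mul1r.
have /and3P[vw wy _] := p; have /= [e2 D0] := inner 0%N isT.
have wN : w \in nset T by apply: sub; rewrite !inE eqxx orbT.
have vN : v \in nset T by apply: sub; rewrite inE eqxx.
have yN : y \in nset T by apply: sub; rewrite !inE eqxx !orbT.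
have [|||j js||m mE] := IH w y.
- by case/andP: p.
- by case/andP: u.
- by move=> x xs; apply: sub; rewrite in_cons xs orbT.
- exact: (inner j.+1).
- by [].
have vy : v != y by apply: contraTneq u => ->; rewrite /= !inE eqxx orbT.
have nbE := neighbours2 vw wy vy vN yN e2.
rewrite [last _ _]/= mE (charnumE vw) e2 /= nbE enum_set1 /= (inner_aval hN hm wN e2 D0) divr1.
have [_ _ [k2 k2E] _] := gcdq2P (dval w)%:~R (gcdq2 (charnum w [set w; y]) 0).
have [_ [k1 k1E] _ _] := gcdq2P (charnum w [set w; y]) 0.
by exists (m * k1 * k2); rewrite {1}k1E {1}k2E !intrM !mulrA.
Qed.

(** Reading the path of a tooth from its foot [v] outwards suits inductions
along the tooth. *)
Lemma toothP (T : decoratedTree) (v : T) (e : {set T}) : tooth v e ->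
  exists w s, [/\ e = [set v; w], path (@adj T) v (w :: s), uniq (v :: w :: s),
     {subset v :: w :: s <= nset T} &
     [/\ forall j, (j < size s)%N -> eps (nth (root T) (w :: s) j) = 2%N /\
           Delta (nth (root T) (w :: s) j) = 0,
         eps (last w s) = 1%N, Delta (last w s) <= 0,
         0 < Delta v + Delta (last w s) &
         Wset v /\ forall x, x \in w :: s -> Vbar v x]].
Proof.
case=> z [zG zv ze]; have [[sz sub [zadj zu] e1 inner] D0 Dpos _] := zG.
case/lastP: z => [|t v'] // in zG zv ze sz sub zadj zu e1 inner D0 Dpos *.
case/lastP: t => [|t w] // in zG zv ze sz sub zadj zu e1 inner D0 Dpos *.
move: zv ze; rewrite !size_rcons /= nth_rcons size_rcons ltnn eqxx => vE; subst v'.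
rewrite !nth_rcons !size_rcons leqnn ltnn eqxx => eE.
have rE : rev (rcons (rcons t w) v) = v :: w :: rev t by rewrite !rev_rcons.
have lastE : last w (rev t) = nth (root T) (rcons (rcons t w) v) 0.
  by case: (t) => //= a t'; rewrite rev_cons last_rcons.
have nthE j : (j <= size t)%N ->
    nth (root T) (w :: rev t) j = nth (root T) (rcons (rcons t w) v) (size t - j).
  move=> jt; rewrite -rev_rcons nth_rev ?size_rcons ?ltnS // subSS.
  by rewrite [RHS]nth_rcons size_rcons ltnS leq_subr.
have innerD j : (j < size t)%N -> eps (nth (root T) (w :: rev t) j) = 2%N /\
    Delta (nth (root T) (w :: rev t) j) = 0.
  move=> jt; rewrite nthE ?(ltnW jt) //; apply: inner.
  by rewrite !size_rcons /= subn_gt0 jt /= ltnS leq_subr.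
exists w, (rev t); split=> //.
- have : sorted (fun a b => adj b a) (rcons (rcons t w) v).
    by apply: sub_sorted zadj => a b; rewrite adjC.
  by rewrite -rev_sorted rE.
- by have := zu; rewrite -rev_uniq rE.
- by move=> x xs; apply: sub; rewrite -mem_rev rE.
split=> //; rewrite ?size_rev ?lastE //.
- move: Dpos; rewrite /DeltaS (eq_bigl (mem (rcons (rcons t w) v))) => [|x]; last by rewrite inE.
  rewrite -big_uniq // (perm_big (rev (rcons (rcons t w) v))) /=; last by rewrite perm_sym perm_rev.
  rewrite rE big_cons -lastE.
  suff sumE a q : (forall j, (j < size q)%N -> Delta (nth (root T) (a :: q) j) = 0) ->
      \sum_(x <- a :: q) Delta x = Delta (last a q).
    by rewrite sumE // => j; rewrite size_rev => /innerD[].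
  elim: q a => [|b q IH] a H; first by rewrite big_seq1.
  by rewrite big_cons (H 0%N isT) add0r IH // => j jq; exact: (H j.+1).
- have lastz : nth (root T) (rcons (rcons t w) v) (size (rcons (rcons t w) v)).-1 = v.
    by rewrite nth_last last_rcons.
  split; first by exists (rcons (rcons t w) v).
  move=> x xs; exists (rcons (rcons t w) v); split=> //.
  by rewrite -mem_rev rE in_cons xs orbT.
Qed.

(** Here [a], [n] and [d u] stand for the dead-end decoration, the multiplicity
and the dicritical degrees at the last vertex of a tooth, and the last two
hypotheses bound its weight [Delta].  The lower bound rules out that every [d u]
is [n]; the upper one then forces [a = 1] and a single [u] with [d u < n], and
the lower bound gives [d u < c] for it. *)
Lemma end_weight_absurd (I : finType) (D : {set I}) (n c : rat) (a : int) (d : I -> rat) :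
  0 < n -> 1 <= a ->
  (forall u, u \in D -> d u = n \/ 2 * d u <= n) ->
  (forall u, u \in D -> a%:~R * c <= d u) ->
  (D = set0 -> a%:~R * c <= n) ->
  1 - n / a%:~R + \sum_(u in D) (n - d u) <= 0 ->
  1 - c < 1 - n / a%:~R + \sum_(u in D) (n - d u) -> False.
Proof.
move=> n0 a1 dn cd c0 le0 gtc.
have a0 : 0 < a%:~R :> rat by rewrite ltr0z; lia.
have pos u : u \in D -> 0 <= n - d u by move=> /dn[->|]; lra.
have half u : u \in D -> d u != n -> n <= 2 * (n - d u) by move=> /dn[->|]; [rewrite eqxx|lra].
have zero (P : pred I) : (forall u, u \in D -> P u -> d u = n) ->
    \sum_(u in D | P u) (n - d u) = 0.
  by move=> H; rewrite big1 // => u /andP[uD Pu]; rewrite H // subrr.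
have [/existsP[u /andP[uD un]]|/existsPn allD] := boolP [exists u, (u \in D) && (d u != n)].
- move: le0 gtc; rewrite (bigD1 u) //=; set S := \sum_(_ in _ | _) _ => le0 gtc.
  have S0 : 0 <= S by apply: sumr_ge0 => w /andP[/pos].
  have hu := half u uD un; have cu := cd u uD.
  have aE : a = 1.
    apply/eqP; rewrite eq_le a1 andbT; have [//|a2] := leP a 1.
    have a2q : 2 <= a%:~R :> rat by rewrite (ler_int _ 2); lia.
    have : n / a%:~R * 2 <= n by rewrite mulrAC ler_pdivrMr // ler_pM2l.
    by lra.
  rewrite aE divr1 mul1r in le0 gtc cu.
  have [/existsP[w /and3P[wD wu wn]]|/existsPn one] :=
      boolP [exists w, [&& w \in D, w != u & d w != n]].
    have : n - d w <= S.
      rewrite /S (bigD1 w) /= ?wD // lerDl; apply: sumr_ge0 => w' /andP[/andP[/pos]].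
      by [].
    by have := half w wD wn; lra.
  have : S = 0.
    apply: zero => w wD wu; apply/eqP; have := one w; rewrite wD wu /= negbK.
    by [].
  by lra.
have dE u : u \in D -> d u = n.
  by move=> uD; apply/eqP; have := allD u; rewrite uD negbK.
have acn : a%:~R * c <= n.
  have [/c0 //|[u uD]] := set_0Vmem D; by rewrite -(dE u uD) cd.
have : c <= n / a%:~R by rewrite ler_pdivlMr // mulrC.
by move: gtc; rewrite big1 => [|u /dE ->]; rewrite ?subrr //; lra.
Qed.

Lemma dval_le_degree (T : decoratedTree) (v u : T) : u \in dicr_at v ->
  (0 < degree u)%N -> dval v <= (degree u)%:Z.
Proof.
move=> uD d0; rewrite /dval; case: eqP => [D0|_]; first by rewrite D0 inE in uD.
by rewrite lez_nat dvdn_leq // (bigD1 u) //= dvdn_gcdl.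
Qed.

(** The foot of such a tooth would have weight [c - 1], with [c] the
characteristic number, and the end of the tooth a weight between [1 - c] and [0]. *)
Lemma tooth_Rval (T : decoratedTree) (v : T) (e : {set T}) :
  newton_tree_at_infinity T -> minimally_complete T ->
  tooth v e -> eps v = 3%N -> Rval v [set e] = 0 -> False.
Proof.
move=> hN hm /toothP[w [s [-> p u sub [inner e1 D0 Dpos _]]]] e3 R0.
have vN : v \in nset T by apply: sub; rewrite mem_head.
have zN : last w s \in nset T by apply: sub; rewrite in_cons mem_last orbT.
have [m mE] := charnum_chain hN hm p u sub inner e1.
rewrite (Delta_of_Rval0 hN hm vN e3 R0) in Dpos.
move: (charnum v [set v; w]) mE Dpos => c mE Dpos {R0 inner p u sub}.
move: (last w s) e1 D0 Dpos zN mE => z e1 D0 Dpos zN mE.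
have n0 := mult_gt0 zN; have a1 := aval_ge1 hN (nset_vertex zN); have a1q := aval_ge1q hN zN.
have a0q : 0 < (aval z)%:~R :> rat by lra.
have d0 x : x \in dicr_at z -> (0 < degree x)%N.
  by move=> xD; have [_ + _ _] := degree_dicritical hN hm zN xD; rewrite ltr0n.
have c1 : 1 < c by lra.
have dz0 : 0 < dval z.
  rewrite /dval; case: eqP => [_|/eqP/set0Pn[x xD]]; first by rewrite -(ltr0z rat).
  by rewrite ltz_nat (bigD1 x) //= gcdn_gt0 d0.
have cd : (aval z)%:~R * c <= (dval z)%:~R.
  have m1 : 1 <= m%:~R :> rat.
    rewrite (ler_int _ 1) -gtz0_ge1 -(ltr0z rat) -(pmulr_lgt0 _ (lt_trans ltr01 c1)) -mE.
    by rewrite divr_gt0 // ltr0z.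
  rewrite mulrC -ler_pdivlMr // mE ler_peMl //; lra.
have DE : Delta z = 1 - (mult z)%:~R / (aval z)%:~R
    + \sum_(x in dicr_at z) ((mult z)%:~R - (degree x)%:R).
  by rewrite DeltaE // e1 -[1%:R]/(1 : rat); ring.
rewrite DE in D0 Dpos.
apply: (@end_weight_absurd _ (dicr_at z) (mult z)%:~R c (aval z) (fun x => (degree x)%:R)) => //.
- move=> x xD; have [k1 dx0 -> [->|k2]] := degree_dicritical hN hm zN xD.
    by left; rewrite mul1r.
  by right; rewrite ler_pM2r.
- move=> x xD; apply: le_trans cd _.
  by have := dval_le_degree xD (d0 x xD); rewrite -(ler_int rat).
- by move=> Dz; move: cd; rewrite /dval Dz eqxx.
- by lra.
Qed.

(** * The skeleton avoids the teeth *)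

Lemma edge_inj (T : rootedTree) (v a b : T) : adj v a -> [set v; a] = [set v; b] -> a = b.
Proof.
move=> va /setP/(_ a); rewrite set22 => /esym/set2P[av|//].
by have := adj_neq va; rewrite av eqxx.
Qed.

Lemma path_in_tooth (T : decoratedTree) (v w : T) (s q : seq T) :
  path (@adj T) v (w :: s) -> uniq (v :: w :: s) -> {subset v :: w :: s <= nset T} ->
  (forall j, (j < size s)%N -> eps (nth (root T) (w :: s) j) = 2%N) ->
  eps (last w s) = 1%N ->
  path (@adj T) v (w :: q) -> uniq (v :: w :: q) -> {subset v :: w :: q <= nset T} ->
  last w q \in w :: s.
Proof.
elim: s v w q => [|y s IH] v w [|c q] sp su sub inner e1 qp qu qsub; rewrite ?mem_head //.
  have /and3P[vw wc _] := qp.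
  have vc : v != c by apply: contraTneq qu => ->; rewrite /= !inE eqxx orbT.
  have cN : c \in nset T by apply: qsub; rewrite !inE eqxx !orbT.
  have vN : v \in nset T by apply: sub; rewrite mem_head.
  have /subset_leq_card : [set v; c] \subset neighbours w.
    by apply/subsetP => x /set2P[] ->; rewrite in_set ?cN ?vN //= adjC.
  by rewrite cards2 vc [X in (_ <= X)%N]e1.
have /and3P[vw wc _] := qp; have /and3P[_ wy _] := sp.
have vc : v != c by apply: contraTneq qu => ->; rewrite /= !inE eqxx orbT.
have vy : v != y by apply: contraTneq su => ->; rewrite /= !inE eqxx orbT.
have cN : c \in nset T by apply: qsub; rewrite !inE eqxx !orbT.
have vN : v \in nset T by apply: sub; rewrite mem_head.
have yN : y \in nset T by apply: sub; rewrite !inE eqxx !orbT.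
have nbE := neighbours2 vw wy vy vN yN (inner 0%N isT).
have cy : c = y by apply/set1P; rewrite -nbE in_setD1 eq_sym vc in_set cN.
subst c; rewrite in_cons [last _ _]/= (IH w y q) ?orbT //.
- by case/andP: sp.
- by case/andP: su.
- by move=> x xs; apply: sub; rewrite in_cons xs orbT.
- by move=> j; exact: (inner j.+1).
- by case/andP: qp.
- by case/andP: qu.
- by move=> x xs; apply: qsub; rewrite in_cons xs orbT.
Qed.

(** A tooth is a whole branch of the subtree: its chain cannot be left, since
its cells have at most two neighbours. *)
Lemma tooth_skeleton (T : decoratedTree) (v w u : T) :
  newton_tree_at_infinity T -> minimally_complete T ->
  adj v w -> tooth v [set v; w] -> u \in branch v w -> skeleton u -> False.
Proof.
move=> hN hm vw /toothP[w' [s [E p us sub [inner e1 _ _ [vW vbar]]]]] uB [uN]; apply.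
have ww' := edge_inj vw E; subst w'.
have vN : v \in nset T by apply: sub; rewrite mem_head.
exists v; split=> //; last by move=> uv; rewrite uv (negPf (branchx _ _)) in uB.
apply: vbar; have [q [qE qp ql qu]] := gammaE w u.
have gE : gamma v u = v :: w :: q by rewrite (gamma_cons vw uB) qE.
rewrite -ql; apply: (path_in_tooth p us sub) => //=; rewrite ?vw //.
- by move=> j /inner[].
- by move: uB; rewrite in_branch qE => ->.
- by move=> x; rewrite -gE; exact: nset_convex.
Qed.

(** * Pairs as branches *)

(** A pair [(u, e)] amounts to the oriented edge that leaves [u] along [e]; it
is determined by the set of cells ahead of it, and the order on pairs becomes
inclusion. *)
Definition ahead (T : decoratedTree) (p : T * {set T}) : {set T} :=
  branch p.1 (other_end p.1 p.2).

Lemma pairsP (T : decoratedTree) (p : T * {set T}) : p \in pairs T ->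
  exists u u0, [/\ p = (u, [set u; u0]), adj u u0, u \in nset T, u0 \in nset T &
    ahead p = branch u u0].
Proof.
case: p => u e; rewrite inE => /and3P[/= uN]; rewrite inE => /andP[eE /subsetP eN] ue.
have [u0 uu0 E] := edge_end eE ue; exists u, u0; split=> //.
- by rewrite -E.
- by apply: eN; rewrite E set22.
- by rewrite /ahead E other_end2 // adj_neq.
Qed.

Lemma mem_pairs (T : decoratedTree) (u u0 : T) : adj u u0 -> u \in nset T -> u0 \in nset T ->
  (u, [set u; u0]) \in pairs T.
Proof.
move=> uu0 uN u0N; rewrite inE /= uN set21 andbT inE [_ \in edges T]uu0 /=.
by apply/subsetP => x /set2P[] ->.
Qed.

Lemma aheadE (T : decoratedTree) (u u0 : T) : adj u u0 ->
  ahead (u, [set u; u0]) = branch u u0.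
Proof. by move=> uu0; rewrite /ahead other_end2 // adj_neq. Qed.

Lemma foot_in (T : rootedTree) (a b w v : T) : adj a b -> adj w v ->
  branch a b \proper branch w v -> a \in branch w v.
Proof.
move=> ab wv /properP[/subsetP sub [c cwv cab]]; have bwv := sub b (branch_in ab).
apply: contraT => awv; have := branch_cross bwv awv.
have ba : adj b a by rewrite adjC.
rewrite (gamma_adj ba) !inE => /orP[] /eqP E.
  by move: bwv; rewrite -E (negPf (branchx _ _)).
subst w; have bv := first_step_uniq ab wv (branch_in ab) bwv.
by rewrite bv cwv in cab.
Qed.

Lemma ahead_inj (T : decoratedTree) (p q : T * {set T}) :
  p \in pairs T -> q \in pairs T -> ahead p = ahead q -> p = q.
Proof.
move=> /pairsP[u [u0 [-> uu0 _ _ ->]]] /pairsP[v [v0 [-> vv0 _ _ ->]]] E.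
by have [-> ->] := branch_inj uu0 vv0 E.
Qed.

Lemma precE (T : decoratedTree) (p q : T * {set T}) :
  p \in pairs T -> q \in pairs T -> prec p q <-> ahead p \proper ahead q.
Proof.
move=> /pairsP[v [v0 [-> vv0 _ _ ->]]] /pairsP[u [u0 [-> uu0 _ _ ->]]].
rewrite /prec /= !gamma_edgesE // mem_gammal mem_gammar /=.
have u0v : adj u0 u by rewrite adjC.
have v0v : adj v0 v by rewrite adjC.
have inE1 : (u0 \in gamma v u) = (v \in branch u u0).
  by rewrite mem_gammaC -branchE.
have inE2 : (v0 \notin gamma v u) = (u \notin branch v v0) by rewrite -branchE.
rewrite inE1 inE2; split=> [/andP[vB uB]|pr].
  have v0u : v0 != u by apply: contraNneq uB => <-; exact: branch_in.
  have sub := branch_sub (branch_in vv0) (branch_step vB vv0 v0u) uB.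
  by rewrite properE sub /=; apply/subsetPn; exists v => //; exact: branchx.
rewrite (foot_in vv0 uu0 pr) /=; apply: contra (branchx u u0).
by apply/subsetP; exact: proper_sub.
Qed.

Lemma preceqE (T : decoratedTree) (p q : T * {set T}) :
  p \in pairs T -> q \in pairs T -> preceq p q <-> ahead p \subset ahead q.
Proof.
move=> pP qP; rewrite subEproper; split=> [[->|/(precE pP qP) ->]|]; rewrite ?eqxx ?orbT //.
by case/predU1P=> [/(ahead_inj pP qP) ->|/(precE pP qP)]; [left|right].
Qed.

(** This allows to walk down the order one pair at a time: either [p] itself
starts at [v], or [v0] is the next cell on the path from [v] to the start of [p]. *)
Lemma next_pair (T : decoratedTree) (p : T * {set T}) (w v : T) :
  newton_tree_at_infinity T -> minimally_complete T ->
  p \in pairs T -> adj w v -> v \in nset T -> ahead p \proper branch w v ->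
  exists v0, [/\ adj v v0, v0 \in nset T, v0 != w, ahead p \subset branch v v0 &
    branch v v0 \proper branch w v].
Proof.
move=> hN hm /pairsP[a [b [_ ab aN bN ->]]] wv vN pr.
have awv := foot_in ab wv pr; have /subsetP sub := proper_sub pr.
have vab : v \notin branch a b.
  apply/negP => vab; have wab : w \notin branch a b.
    by apply: contra (branchx w v); exact: sub.
  have := branch_cross vab wab; rewrite gamma_adj 1?adjC // !inE => /orP[] /eqP E.
    by rewrite E (negPf (branchx _ _)) in vab.
  by rewrite E (negPf (branchx _ _)) in awv.
suff [v0 [vv0 v0N v0w ?]] : exists v0, [/\ adj v v0, v0 \in nset T, v0 != w &
    branch a b \subset branch v v0].
  by exists v0; split=> //; exact: branch_proper.
have [av|av] := eqVneq v a.
  exists b; rewrite av; split=> //.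
  by apply: contraNneq (branchx w v) => bw; rewrite -{1}bw; apply: sub; exact: branch_in.
have [v0 vv0 aB] := first_step av; exists v0; split=> //.
- by apply: (nset_convex hN hm vN aN); rewrite -branchE.
- by apply: contraTneq aB => ->; rewrite (branchC wv) in_setC negbK.
- have bv : b != v by apply: contraNneq vab => <-; exact: branch_in.
  exact: branch_sub (branch_in ab) (branch_step aB ab bv) vab.
Qed.

(** * Combs *)

Lemma third_edgeP (T : decoratedTree) (u v w w' v0 : T) :
  adj v w -> adj v w' -> adj v v0 -> v \in nset T -> w' \in nset T ->
  w != w' -> v0 != w' -> u \in branch v w -> third_edge u v [set v; v0] [set v; w'].
Proof.
move=> vw vw' vv0 vN w'N ww' v0w' uB; split.
- rewrite inE [_ \in edges T]vw' /=.
  by apply/subsetP => x /set2P[] ->.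
- exact: set21.
- rewrite gamma_edgesE // mem_gammar /=; apply: contra ww'.
  by rewrite mem_gammaC -branchE // => /(first_step_uniq vw vw' uB) ->.
- by apply: contra v0w' => /eqP/(edge_inj vw') ->.
Qed.

Lemma eps_three (T : decoratedTree) (v a b c : T) : adj v a -> adj v b -> adj v c ->
  a \in nset T -> b \in nset T -> c \in nset T -> a != b -> a != c -> b != c ->
  eps v = 2%N \/ eps v = 3%N -> eps v = 3%N.
Proof.
move=> va vb vc aN bN cN ab ac bc [e2|//]; have /subset_leq_card : a |: [set b; c] \subset neighbours v.
  by apply/subsetP => x /setU1P[->|/set2P[]->]; rewrite in_set ?aN ?bN ?cN.
by rewrite cardsU1 !inE negb_or ab ac cards2 bc [X in (_ <= X)%N]e2.
Qed.

(** Every path to [v] from outside [ahead q] passes through the edge of [q], so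
all these paths enter [v] by the same edge. *)
Lemma third_edge_start (T : decoratedTree) (q : T * {set T}) (v v0 u : T) (g : {set T}) :
  q \in pairs T -> adj v v0 -> branch v v0 \proper ahead q -> u \notin ahead q ->
  third_edge q.1 v [set v; v0] g <-> third_edge u v [set v; v0] g.
Proof.
move=> /pairsP[a [b [-> ab _ _ ->]]] vv0 pr uab /=.
have vab := foot_in vv0 ab pr.
have fwd w : adj v w -> a \in branch v w -> u \in branch v w.
  move=> vw aB; have wv : adj w v by rewrite adjC.
  have awv : a \notin branch w v by rewrite (branchC vw) in_setC aB.
  have /subsetP sub := branch_sub (branch_in wv) vab awv.
  by apply: contraNT uab => uB; apply: sub; rewrite (branchC vw) in_setC.
have same w : adj v w -> (a \in branch v w) = (u \in branch v w).
  move=> vw; apply/idP/idP => [|uB]; first exact: fwd.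
  have va : v != a by apply: contraTneq vab => ->; exact: branchx.
  have [w' vw' aB] := first_step va.
  by rewrite (first_step_uniq vw vw' uB (fwd _ vw' aB)).
suff E : g \in nedges T -> v \in g -> (g \in gamma_edges a v) = (g \in gamma_edges u v).
  by split=> -[gN vg gu gf]; split=> //; [rewrite -E | rewrite E].
rewrite inE => /andP[gE _] vg; have [w vw ->] := edge_end gE vg.
by rewrite !gamma_edgesE // !mem_gammar /= !(mem_gammaC v) -!branchE // same.
Qed.

Lemma ahead_proper (T : decoratedTree) (p : T * {set T}) : p \in pairs T ->
  exists2 s, s \in ahead p & p.1 \notin ahead p.
Proof.
by case/pairsP=> a [b [-> ab _ _ ->]]; exists b; [exact: branch_in | exact: branchx].
Qed.

Lemma ahead_nested (T : decoratedTree) (p q r x : T * {set T}) :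
  p \in pairs T -> q \in pairs T -> r \in pairs T -> x \in pairs T ->
  ahead r \subset ahead p -> ahead r \subset ahead q ->
  ahead p \subset ahead x -> ahead q \subset ahead x ->
  ahead p \subset ahead q \/ ahead q \subset ahead p.
Proof.
move=> pP qP rP xP /subsetP rp /subsetP rq /subsetP px /subsetP qx.
have [s sr _] := ahead_proper rP; have [? _ xx] := ahead_proper xP.
have := rp _ sr; have := rq _ sr; have := contra (px x.1) xx; have := contra (qx x.1) xx.
move: pP qP {rp rq px qx xx} => /pairsP[a [b [_ ab _ _ ->]]] /pairsP[v [w [_ vw _ _ ->]]].
by move=> xq xp sq sp; exact: branch_nested ab vw sp sq xp xq.
Qed.

Definition comb_condition (T : decoratedTree) (u v : T) (f : {set T}) : Prop :=
  [/\ eps v = 2%N \/ eps v = 3%N, eps v = 2%N -> Rval v [set f] < 1 &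
      eps v = 3%N -> Rval v [set f] = 0 /\
        exists2 g, unique (third_edge u v f) g & tooth v g].

Lemma combP (T : decoratedTree) (x y : T * {set T}) : x \in pairs T -> y \in pairs T ->
  comb_over x y <-> ahead y \subset ahead x /\
    forall r, r \in pairs T -> ahead r \proper ahead x -> ahead y \subset ahead r ->
      comb_condition x.1 r.1 r.2.
Proof.
move=> xP yP; split=> [[/(preceqE yP xP) yx H]|[yx H]].
  split=> // -[v f] rP /(precE rP xP) rx /(preceqE yP rP) yr; exact: H rP rx yr.
split=> [|v f rP /(precE rP xP) rx /(preceqE yP rP) yr]; first exact/(preceqE yP xP).
exact: H rP rx yr.
Qed.

Lemma comb_condition_start (T : decoratedTree) (q r : T * {set T}) (u : T) :
  q \in pairs T -> r \in pairs T -> ahead r \proper ahead q -> u \notin ahead q ->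
  comb_condition q.1 r.1 r.2 <-> comb_condition u r.1 r.2.
Proof.
move=> qP /pairsP[v [v0 [-> vv0 _ _ ->]]] rq uq /=.
have E g := third_edge_start g qP vv0 rq uq.
by split=> -[e23 e2 e3]; split=> // /e3[R0 [g [gT gU] gt]]; split=> //; exists g => //;
  split=> [|h /E/gU //]; apply/E.
Qed.

Lemma comb_refl (T : decoratedTree) (p : T * {set T}) : p \in pairs T -> comb_over p p.
Proof.
move=> pP; apply/(combP pP pP); split=> // r _ rp pr.
by move: rp; rewrite properE pr andbF.
Qed.

Lemma comb_sub (T : decoratedTree) (x y x' y' : T * {set T}) :
  x \in pairs T -> y \in pairs T -> x' \in pairs T -> y' \in pairs T ->
  ahead y \subset ahead y' -> ahead y' \subset ahead x' -> ahead x' \subset ahead x ->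
  comb_over x y -> comb_over x' y'.
Proof.
move=> xP yP x'P y'P yy' yx' xx' /(combP xP yP)[_ H]; apply/(combP x'P y'P).
split=> // r rP rx' yr; have [s _ xx] := ahead_proper xP.
apply/(comb_condition_start x'P rP rx' (contra (subsetP xx' _) xx)).
by apply: H rP (proper_sub_trans rx' xx') (subset_trans yy' yr).
Qed.

Lemma comb_trans (T : decoratedTree) (x y z : T * {set T}) :
  x \in pairs T -> y \in pairs T -> z \in pairs T ->
  comb_over x y -> comb_over y z -> comb_over x z.
Proof.
move=> xP yP zP /(combP xP yP)[yx Hxy] /(combP yP zP)[zy Hyz].
apply/(combP xP zP); split=> [|r rP rx zr]; first exact: subset_trans zy yx.
have [yr|ry] := ahead_nested yP rP zP xP zy zr yx (proper_sub rx); first exact: Hxy.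
have [yr|nyr] := boolP (ahead y \subset ahead r); first exact: Hxy.
have [s _ xx] := ahead_proper xP.
have pr : ahead r \proper ahead y by rewrite properE ry.
apply/(comb_condition_start yP rP pr (contra (subsetP yx _) xx)).
exact: Hyz.
Qed.

(** The situation where two descending chains of pairs meet or part: the path
from [x] to [p] goes through [w], [v] and [v0], while [w'] is a third direction
at [v], which the comb condition declares to be a tooth. *)
Lemma comb_fork (T : decoratedTree) (x p : T * {set T}) (w v v0 w' : T) :
  x \in pairs T -> p \in pairs T -> comb_over x p ->
  w \in nset T -> v \in nset T -> v0 \in nset T -> w' \in nset T ->
  adj w v -> adj v v0 -> adj v w' -> w != v0 -> w != w' -> v0 != w' ->
  branch w v \subset ahead x -> ahead p \subset branch v v0 ->
  branch v v0 \proper branch w v ->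
  [/\ eps v = 3%N, Rval v [set [set v; v0]] = 0 & tooth v [set v; w']].
Proof.
move=> xP pP /(combP xP pP)[_ H] wN vN v0N w'N wv vv0 vw' wv0 ww' v0w' mx pv vm.
have vw : adj v w by rewrite adjC.
have rP := mem_pairs vv0 vN v0N.
have [|/=|/= e23 _ e3] := H _ rP; rewrite ?aheadE //; first exact: proper_sub_trans vm mx.
have e := eps_three vw vv0 vw' wN v0N w'N wv0 ww' v0w' e23.
have [R0 [g [_ gU] gt]] := e3 e; split=> //.
rewrite -(gU [set v; w']) //; apply: (third_edgeP vw) => //.
have [s _ xx] := ahead_proper xP.
by have := contra (subsetP mx _) xx; rewrite (branchC vw) in_setC negbK.
Qed.

(** Two combs over the same pair: where their paths towards it meet, one path
would arrive along a tooth, hence start off the skeleton. *)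
Lemma comb_join (T : decoratedTree) (x z y : T * {set T}) :
  newton_tree_at_infinity T -> minimally_complete T ->
  x \in pairs T -> z \in pairs T -> y \in pairs T -> skeleton z.1 ->
  comb_over x y -> comb_over z y ->
  ahead x \subset ahead z \/ ahead z \subset ahead x.
Proof.
move=> hN hm xP zP yP zS xy zy.
have [xz|xz] := boolP (ahead x \subset ahead z); [by left|right].
have [yx _] := (combP xP yP).1 xy; have [yz _] := (combP zP yP).1 zy.
pose C m := [&& m \in pairs T, ahead y \subset ahead m, ahead m \subset ahead x
               & ~~ (ahead m \subset ahead z)].
have Cx : C x by rewrite /C xP yx subxx.
(* A smallest such pair is the last one before the path from [x] joins that from [z]. *)
have [m /and4P[mP ym mx mz] mmin] := arg_minnP (fun m => #|ahead m|) Cx.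
have ym' : ahead y \proper ahead m.
  by rewrite properE ym /=; apply: contra mz => /subset_trans; apply.
have [w [v [mE wv wN vN amE]]] := pairsP mP.
rewrite amE in ym' mx mz mmin.
have [v0 [vv0 v0N v0w yv vm]] := next_pair hN hm yP wv vN ym'.
have vw : adj v w by rewrite adjC.
have nP := mem_pairs vv0 vN v0N.
have vz : branch v v0 \subset ahead z.
  apply: contraLR (proper_card vm) => vz; rewrite -leqNgt -(aheadE vv0); apply: mmin.
  by rewrite /C nP aheadE // yv (subset_trans (proper_sub vm) mx).
have [zv|/eqP zv] := eqVneq (ahead z) (branch v v0).
  by rewrite zv (subset_trans (proper_sub vm) mx).
have vz' : branch v v0 \proper ahead z by rewrite properEneq vz eq_sym andbT; apply/eqP.
have [c [c0 [zE cc0 cN _ azE]]] := pairsP zP; rewrite azE in mz vz' vz.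
have vB := foot_in vv0 cc0 vz'.
have vc : v != c by apply: contraTneq vB => ->; exact: branchx.
have [w' vw' cB] := first_step vc.
have w'N : w' \in nset T by apply: (nset_convex hN hm vN cN); rewrite -branchE.
have ww' : w != w'.
  apply: contraNneq mz => E; apply: branch_sub (branch_in wv) vB _.
  by rewrite (branchC vw) in_setC E cB.
have v0w' : v0 != w'.
  by apply: contraNneq (branchx c c0) => E; apply: (subsetP vz); rewrite E.
have wv0 : w != v0 by rewrite eq_sym.
have [_ _ t] := comb_fork xP yP xy wN vN v0N w'N wv vv0 vw' wv0 ww' v0w' mx yv vm.
by exfalso; apply: tooth_skeleton hN hm vw' t cB _; move: zS; rewrite zE.
Qed.

(** One comb over two pairs: where the paths towards them part, both ways on
would be teeth along which [R] vanishes. *)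
Lemma comb_split (T : decoratedTree) (x y z : T * {set T}) :
  newton_tree_at_infinity T -> minimally_complete T ->
  x \in pairs T -> y \in pairs T -> z \in pairs T ->
  comb_over x y -> comb_over x z ->
  ahead y \subset ahead z \/ ahead z \subset ahead y.
Proof.
move=> hN hm xP yP zP xy xz.
have [yx _] := (combP xP yP).1 xy; have [zx _] := (combP xP zP).1 xz.
pose C m := [&& m \in pairs T, ahead y \subset ahead m, ahead z \subset ahead m
               & ahead m \subset ahead x].
have Cx : C x by rewrite /C xP yx zx subxx.
(* A smallest such pair is the last one common to the paths towards [y] and [z]. *)
have [m /and4P[mP ym zm mx] mmin] := arg_minnP (fun m => #|ahead m|) Cx.
have [->|/eqP ny] := eqVneq (ahead y) (ahead m); first by right.
have [->|/eqP nz] := eqVneq (ahead z) (ahead m); first by left.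
have [w [v [_ wv wN vN amE]]] := pairsP mP; rewrite amE in ym zm mx mmin ny nz.
have ym' : ahead y \proper branch w v by rewrite properEneq ym andbT; apply/eqP.
have zm' : ahead z \proper branch w v by rewrite properEneq zm andbT; apply/eqP.
have [a [va aN aw ya am]] := next_pair hN hm yP wv vN ym'.
have [b [vb bN bw zb bm]] := next_pair hN hm zP wv vN zm'.
have ab : a != b.
  apply: contraTneq (proper_card am) => E; rewrite -leqNgt -(aheadE va); apply: mmin.
  by rewrite /C mem_pairs // aheadE // ya {1}E zb (subset_trans (proper_sub am) mx).
have ba : b != a by rewrite eq_sym.
rewrite eq_sym in aw; rewrite eq_sym in bw.
have [e3 R0 _] := comb_fork xP yP xy wN vN aN bN wv va vb aw bw ab mx ya am.
have [_ _ t] := comb_fork xP zP xz wN vN bN aN wv vb va bw aw ba mx zb bm.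
by case: (tooth_Rval hN hm t e3 R0).
Qed.

Theorem theorem6p4 (T : decoratedTree)
    (hN : newton_tree_at_infinity T) (hmin : minimally_complete T) :
  equivalence_on (@PS T) (@comb_equiv T) /\
  (forall p : T * {set T}, PS p ->
     total_order_on (class_on (@PS T) (@comb_equiv T) p) (@preceq T)).
Proof.
have sym (x y : T * {set T}) : comb_equiv x y -> comb_equiv y x by case; [right|left].
have comp (x z y : T * {set T}) : PS x -> PS z -> PS y -> comb_over x y -> comb_over z y ->
    comb_equiv x z.
  move=> [xP _] [zP zS] [yP _] xy zy.
  have [yx _] := (combP xP yP).1 xy; have [yz _] := (combP zP yP).1 zy.
  have [xz|zx] := comb_join hN hmin xP zP yP zS xy zy; [right|left].
    exact: (comb_sub zP yP zP xP yx xz (subxx _) zy).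
  exact: (comb_sub xP yP xP zP yz zx (subxx _) xy).
have comp' (x y z : T * {set T}) : PS x -> PS y -> PS z -> comb_over x y -> comb_over x z ->
    comb_equiv y z.
  move=> [xP _] [yP _] [zP _] xy xz.
  have [yx _] := (combP xP yP).1 xy; have [zx _] := (combP xP zP).1 xz.
  have [yz|zy] := comb_split hN hmin xP yP zP xy xz; [right|left].
    exact: (comb_sub xP yP zP yP (subxx _) yz zx xy).
  exact: (comb_sub xP zP yP zP (subxx _) zy yx xz).
have trans (x y z : T * {set T}) : PS x -> PS y -> PS z -> comb_equiv x y -> comb_equiv y z -> comb_equiv x z.
  move=> xS yS zS; have [xP _] := xS; have [yP _] := yS; have [zP _] := zS.
  case=> [xy|yx] [yz|zy].
  - by left; exact: (comb_trans xP yP zP xy yz).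
  - exact: (comp x z y).
  - exact: (comp' y x z).
  - by right; exact: (comb_trans zP yP xP zy yx).
split.
  split=> [x [xP _]|x y _ _ /sym //|]; last exact: trans.
  by left; exact: comb_refl.
move=> p pS; split=> [x _|x y [[xP _] _] [[yP _] _]|x y z [[xP _] _] [[yP _] _] [[zP _] _]|
    x y [xS px] [yS py]].
- by left.
- move=> /(preceqE xP yP) xy /(preceqE yP xP) yx; apply: ahead_inj => //.
  by apply/eqP; rewrite eqEsubset xy yx.
- move=> /(preceqE xP yP) xy /(preceqE yP zP) yz; apply/(preceqE xP zP).
  exact: subset_trans xy yz.
by case: (trans x p y xS pS yS (sym _ _ px) py) => -[]; [right|left].
Qed.
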